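(* The Diophantine problem in each of the groups $GL(3,\mathbb{Z})$, $SL(3,\mathbb{Z})$, and $T(3,\mathbb{Z})$ is undecidable.
   Context: $T(3,\mathbb{Z})$ is the group of invertible upper triangular $3\times 3$ matrices over $\mathbb{Z}$. For a finitely generated group $G$, the Diophantine problem is the problem of deciding, given a finite system of equations (equalities of group words in variables and coefficients from $G$, the coefficients being given as words in a fixed finite generating set of $G$), whether it has a solution in $G$. It is undecidable if no algorithm solves it. *)

(* Defs.v *)
From HB Require Import structures.
From mathcomp Require Import all_boot all_order all_fingroup all_algebra.
Set Implicit Arguments.
Unset Strict Implicit.
Unset Printing Implicit Defensive.

Import GRing.Theory.

(** * Algorithms: Minsky register machines *)

(* [Inc r] increments register [r] and moves to the next instruction;
   [Dec r p] jumps to instruction [p] if register [r] is zero, and otherwise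
   decrements [r] and moves to the next instruction.  The machine halts when
   the program counter leaves the program.  With arbitrarily many registers,
   these machines compute exactly the partial recursive functions. *)
Inductive instr := Inc of nat | Dec of nat & nat.

Definition machine := seq instr.

(* program counter and register contents *)
Definition config := (nat * (nat -> nat))%type.

Definition upd (v : nat -> nat) (r m : nat) : nat -> nat :=
  fun k => if k == r then m else v k.

Definition step (M : machine) (c : config) : config :=
  let: (pc, v) := c in
  match onth M pc with
  | Some (Inc r) => (pc.+1, upd v r (v r).+1)
  | Some (Dec r p) => if v r is m.+1 then (pc.+1, upd v r m) else (p, v)
  | None => c
  end.

(* Input in register 0, all other registers zero; output in register 0. *)
Definition computes (M : machine) (n m : nat) : Prop :=
  exists t : nat,
    let c := iter t (step M) (0, upd (fun=> 0) 0 n) in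
    size M <= c.1 /\ c.2 0 = m.

(* A decision problem with instances [i : I], presented to the machine as
   [code i], is decidable if some machine halts on every instance, with output
   1 if [P i] holds and 0 otherwise. *)
Definition decidable_problem (I : Type) (code : I -> nat) (P : I -> Prop) :
    Prop :=
  exists M : machine, forall i : I,
    exists b : bool, computes M (code i) b /\ (b <-> P i).

(** * Group words and equations *)

(* Group words over an alphabet; the letter [(a, true)] stands for [a^-1]. *)
Definition gword (A : Type) := seq (A * bool).

Definition gval (G : groupType) (A : Type) (f : A -> G) (w : gword A) : G :=
  (\prod_(l <- w) (if l.2 then (f l.1)^-1 else f l.1))%g.

Definition generating (G : groupType) (k : nat) (gens : k.-tuple G) : Prop :=
  forall a : G, exists w : gword 'I_k, gval (tnth gens) w = a.

(* The letters of equations with coefficients in a group with [k] generators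
   are the variables [inl i] and the generators [inr j]. *)
Definition equation (k : nat) :=
  (gword (nat + 'I_k) * gword (nat + 'I_k))%type.

Definition system (k : nat) := seq (equation k).

Definition valuation (G : groupType) (k : nat) (gens : k.-tuple G)
    (x : nat -> G) (s : nat + 'I_k) : G :=
  match s with inl i => x i | inr j => tnth gens j end.

Definition solves (G : groupType) (k : nat) (gens : k.-tuple G)
    (x : nat -> G) (e : equation k) : Prop :=
  gval (valuation gens x) e.1 = gval (valuation gens x) e.2.

Definition solvable_system (G : groupType) (k : nat) (gens : k.-tuple G)
    (S : system k) : Prop :=
  exists x : nat -> G, forall e : equation k, e \in S -> solves gens x e.

(* Goedel numbering of systems; [CodeSeq.code] is the library's effective
   bijection from [seq nat] to [nat]. *)
Definition code_letter (k : nat) (l : (nat + 'I_k) * bool) : nat :=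
  (match l.1 with inl i => i.*2 | inr j => (j : nat).*2.+1 end).*2 + l.2.

Definition code_word (k : nat) (w : gword (nat + 'I_k)) : nat :=
  CodeSeq.code (map (@code_letter k) w).

Definition code_equation (k : nat) (e : equation k) : nat :=
  CodeSeq.code [:: code_word e.1; code_word e.2].

Definition code_system (k : nat) (S : system k) : nat :=
  CodeSeq.code (map (@code_equation k) S).

Lemma code_letter_inj k : injective (@code_letter k).
Proof.
have dblI (m n : nat) (b c : bool) : m.*2 + b = n.*2 + c -> m = n /\ b = c.
  rewrite ![_.*2 + _]addnC => e; have eb : b = c.
    by have := congr1 odd e; rewrite !oddD !odd_double !addbF !oddb.
  by split=> //; move: e; rewrite eb => /addnI/double_inj.
move=> [s b] [t c] /dblI[/= + ->]; case: s t => [i|i] [j|j] e.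
- by rewrite (double_inj e).
- by have := congr1 odd e; rewrite /= !odd_double.
- by have := congr1 odd e; rewrite /= !odd_double.
- by case: e => /double_inj/val_inj->.
Qed.

Lemma code_system_inj k : injective (@code_system k).
Proof.
have codeI := can_inj CodeSeq.codeK.
have wordI : injective (@code_word k).
  by move=> u v e; apply: (inj_map (@code_letter_inj k)); apply: codeI.
have eqnI : injective (@code_equation k).
  by move=> [u v] [u' v'] e; case: (codeI _ _ e) => /wordI-> /wordI->.
by move=> S1 S2 e; apply: (inj_map eqnI); apply: codeI.
Qed.

(** * The Diophantine problem *)

(* Undecidability is required with respect to every finite generating set,
   although whether the problem is decidable does not depend on that choice. *)
Definition diophantine_undecidable (G : groupType) : Prop :=
  forall (k : nat) (gens : k.-tuple G), generating gens ->
    ~ decidable_problem (@code_system k) (solvable_system gens).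

(** * The groups GL(n, R), SL(n, R), T(n, R) *)

Section LinearGroups.
Variables (R : comUnitRingType) (n : nat).
Local Open Scope ring_scope.

Record GL := MkGL { GLmx :> 'M[R]_n; _ : GLmx \in unitmx }.

HB.instance Definition _ := [isSub for GLmx].
HB.instance Definition _ := [Choice of GL by <:].

Definition GL_one : GL := MkGL (unitmx1 R n).

Fact GL_inv_subproof (A : GL) : invmx A \in unitmx.
Proof. by rewrite unitmx_inv (valP A). Qed.
Definition GL_inv (A : GL) : GL := MkGL (GL_inv_subproof A).

Fact GL_mul_subproof (A B : GL) : A *m B \in unitmx.
Proof. by rewrite unitmx_mul (valP A) (valP B). Qed.
Definition GL_mul (A B : GL) : GL := MkGL (GL_mul_subproof A B).

Fact GL_mulA : associative GL_mul.
Proof. by move=> A B C; apply/val_inj/mulmxA. Qed.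
Fact GL_mul1 : left_id GL_one GL_mul.
Proof. by move=> A; apply/val_inj/mul1mx. Qed.
Fact GL_mulr1 : right_id GL_one GL_mul.
Proof. by move=> A; apply/val_inj/mulmx1. Qed.
Fact GL_mulV : left_inverse GL_one GL_inv GL_mul.
Proof. by move=> A; apply/val_inj/(mulVmx (valP A)). Qed.
Fact GL_mulVr : right_inverse GL_one GL_inv GL_mul.
Proof. by move=> A; apply/val_inj/(mulmxV (valP A)). Qed.

HB.instance Definition _ :=
  isGroup.Build GL GL_mulA GL_mul1 GL_mulr1 GL_mulV GL_mulVr.

Definition SLpred : {pred GL} := [pred A : GL | \det A == 1].

Record SL := MkSL { SLval :> GL; _ : SLval \in SLpred }.

HB.instance Definition _ := [isSub for SLval].
HB.instance Definition _ := [Choice of SL by <:].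

Fact SL_closed : group_closed SLpred.
Proof.
split=> [|A B]; rewrite !inE ?det1 // => /eqP dA /eqP dB.
by rewrite det_mulmx /= det_inv dA dB invr1 mulr1.
Qed.

HB.instance Definition _ := SubChoice_isSubGroup.Build GL SLpred SL SL_closed.

(* [is_trig_mx] is lower triangularity, hence the transpose. *)
Definition Tpred : {pred GL} := [pred A : GL | is_trig_mx (GLmx A)^T].

Record T := MkT { Tval :> GL; _ : Tval \in Tpred }.

HB.instance Definition _ := [isSub for Tval].
HB.instance Definition _ := [Choice of T by <:].

Lemma is_trig_mulmx (A B : 'M[R]_n) :
  is_trig_mx A -> is_trig_mx B -> is_trig_mx (A *m B).
Proof.
move=> /is_trig_mxP tA /is_trig_mxP tB; apply/is_trig_mxP => i j ij.
rewrite mxE big1 // => k _; case: (ltnP i k) => [ik|ki].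
  by rewrite tA ?mul0r.
by rewrite tB ?mulr0 // (leq_ltn_trans ki).
Qed.

Lemma is_trig_invmx (A : 'M[R]_n) :
  A \in unitmx -> is_trig_mx A -> is_trig_mx (invmx A).
Proof.
move=> uA trA; have uAii i : A i i \is a GRing.unit.
  move: uA; rewrite unitmxE det_trig // (bigD1 i) //=.
  by rewrite unitrM => /andP[].
have tA := is_trig_mxP trA.
suff H m (i j : 'I_n) : (i < m)%N -> (i < j)%N -> invmx A i j = 0.
  by apply/is_trig_mxP => i j; apply: (H i.+1).
elim: m i j => // m IH i j im ij; apply: (mulrI (uAii i)).
have := congr1 (fun C : 'M_n => C i j) (mulmxV uA).
rewrite !mxE (bigD1 i) //= big1 => [|k].
  by rewrite addr0 mulr0 -val_eqE (ltn_eqF ij) => ->.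
rewrite neq_ltn => /orP[ki|ik]; last by rewrite tA ?mul0r.
by rewrite IH ?mulr0 ?(leq_trans ki im) ?(ltn_trans ki ij).
Qed.

Fact T_closed : group_closed Tpred.
Proof.
split=> [|A B]; rewrite !inE /=.
  by rewrite trmx1 scalar_mx_is_trig.
move=> tA tB; rewrite trmx_mul trmx_inv is_trig_mulmx ?is_trig_invmx //.
by rewrite unitmx_tr (valP B).
Qed.

HB.instance Definition _ := SubChoice_isSubGroup.Build GL Tpred T T_closed.

End LinearGroups.

(* Main.v *)
Require Import Defs.
From HB Require Import structures.
From mathcomp Require Import all_boot all_order all_fingroup all_algebra.
From mathcomp Require Import zify ring.
From Stdlib Require Import FunctionalExtensionality.
Set Implicit Arguments.
Unset Strict Implicit.
Unset Printing Implicit Defensive.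

(* In each of the three groups the ring of integers is interpreted by systems of
   equations on the elements t13(a) = 1 + a E13: the elements commuting with
   t12 and t13 (resp. t23 and t13) are, up to sign, the t12(a) t13(b) (resp.
   t23(a) t13(b)), and [t12(a), t23(b)] = t13(ab).  By the theorem of
   Matiyasevich, Robinson, Davis and Putnam, every set accepted by a register
   machine is then defined by a system of equations: exponentiation is defined
   through Pell equations, and machine runs through binary masking.  Now let a
   machine M decide the Diophantine problem.  The set of all n such that M
   rejects the number of the system n with the equation "parameter = n" added is
   defined by a system; adding to that system the equation "parameter = its own
   number" contradicts the correctness of M. *)

Import GRing.Theory Num.Theory Order.TTheory.

(** Systems over the naturals, the integers and the group are all used, so closure properties and
    the passage between structures are proved once, for an abstract [language]. Two obstacles shape
    the rest. An element centralising t12 and t13 carries an unknown diagonal entry e, so integers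
    are read off as quotients by e, and the sign cancels. And the diagonal system has to speak of
    its own number: the added equation is x_0 ^+ n = x_2, where the variable x_0 is forced to be
    t13(1). It contains no generators, so the number of the enlarged system is an explicit
    exponential expression in n, and the definability of exponentiation makes the self-reference
    expressible. *)

Record language := Language {
  dom : Type;
  atom : Type;
  sat : (nat -> dom) -> atom -> Prop;
  ren : (nat -> nat) -> atom -> atom;
  sat_ren : forall f X c, sat X (ren f c) <-> sat (X \o f) c }.

Definition mix (D : Type) (v w : nat -> D) (i : nat) : D :=
  if odd i then w i./2 else v i./2.

Lemma mix_double D (v w : nat -> D) i : mix v w i.*2 = v i.
Proof. by rewrite /mix odd_double doubleK. Qed.

Lemma mix_doubleS D (v w : nat -> D) i : mix v w i.*2.+1 = w i.
Proof. by rewrite /mix /= odd_double /= uphalf_double. Qed.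

Lemma mix_even D (v w : nat -> D) : (fun i => mix v w i.*2) = v.
Proof. by apply: functional_extensionality => i; rewrite mix_double. Qed.

Lemma mix_odd D (v w : nat -> D) : (fun i => mix v w i.*2.+1) = w.
Proof. by apply: functional_extensionality => i; rewrite mix_doubleS. Qed.

Definition scons (D : Type) (x : D) (v : nat -> D) (i : nat) : D :=
  if i is j.+1 then v j else x.

(** * Closure properties of relations defined by finite systems *)

Section Definability.
Variable L : language.
Implicit Types (P Q : (nat -> dom L) -> Prop) (S : seq (atom L)).

Fixpoint sats (X : nat -> dom L) S : Prop :=
  if S is c :: S' then sat X c /\ sats X S' else True.

Lemma sats_cat X S1 S2 : sats X (S1 ++ S2) <-> sats X S1 /\ sats X S2.
Proof. by elim: S1 => [|c S IH] /=; tauto. Qed.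

Lemma sats_ren f X S : sats X (map (@ren L f) S) <-> sats (X \o f) S.
Proof. by elim: S => [|c S IH] //=; have := sat_ren f X c; tauto. Qed.

(* Free variables of [P] sit at the even indices of the system, the
   existentially quantified auxiliary ones at the odd indices. *)
Definition definable P : Prop :=
  exists S, forall v, P v <-> exists w, sats (mix v w) S.

Lemma definable_iff P Q :
  (forall v, P v <-> Q v) -> definable P -> definable Q.
Proof. by move=> PQ [S SP]; exists S => v; rewrite -PQ. Qed.

Lemma definable_atom c : definable (fun v => sat v c).
Proof.
exists [:: ren double c] => v /=.
have E w : mix v w \o double = v.
  by apply: functional_extensionality => i /=; rewrite mix_double.
split=> [h|[w [/sat_ren]]]; last by rewrite E.
by exists v; split=> //; apply/sat_ren; rewrite E.
Qed.

Lemma definable_true : definable (fun=> True).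
Proof. by exists [::] => v; split=> // _; exists v. Qed.

(** The auxiliary variables of the two systems must not clash: [f] moves the first kind to indices
    4j+1, [g] the second to 4j+3, and free variables stay at even indices. *)
Lemma definable_and P Q :
  definable P -> definable Q -> definable (fun v => P v /\ Q v).
Proof.
move=> [S SP] [S' SQ].
pose f i := if odd i then (i./2.*2).*2.+1 else i.
pose g i := if odd i then (i./2.*2.+1).*2.+1 else i.
have Ef v w : mix v w \o f = mix v (fun i => w i.*2).
  apply: functional_extensionality => i; rewrite /= /f {2}/mix.
  case: ifP => oi; first by rewrite mix_doubleS.
  by rewrite /mix oi.
have Eg v w : mix v w \o g = mix v (fun i => w i.*2.+1).
  apply: functional_extensionality => i; rewrite /= /g {2}/mix.
  case: ifP => oi; first by rewrite mix_doubleS.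
  by rewrite /mix oi.
exists (map (@ren L f) S ++ map (@ren L g) S') => v.
split=> [[/SP[w sw] /SQ[w' sw']]|[w /sats_cat[/sats_ren + /sats_ren]]].
  exists (mix w w'); apply/sats_cat; split; apply/sats_ren; rewrite ?Ef ?Eg.
    by rewrite mix_even.
  by rewrite mix_odd.
by rewrite Ef Eg => h h'; split; [apply/SP|apply/SQ]; eexists; eassumption.
Qed.

Lemma definable_ren (f : nat -> nat) P :
  definable P -> definable (fun v => P (v \o f)).
Proof.
move=> [S SP]; pose g i := if odd i then i else (f i./2).*2.
have Eg v w : mix v w \o g = mix (v \o f) w.
  apply: functional_extensionality => i; rewrite /= /g {2}/mix.
  case: ifP => oi; first by rewrite /mix oi.
  by rewrite mix_double.
exists (map (@ren L g) S) => v; split=> [/SP[w sw]|[w /sats_ren]].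
  by exists w; apply/sats_ren; rewrite Eg.
by rewrite Eg => h; apply/SP; exists w.
Qed.

(** The bound block moves to the odd indices 4j+3 and the old auxiliary variables to 4j+1, which
    frees all even indices for [v]. *)
Lemma definable_exs P :
  definable P -> definable (fun v => exists w, P (mix v w)).
Proof.
move=> [S SP].
pose f i := if odd i then (i./2.*2).*2.+1 else
  if odd i./2 then (i./2./2.*2.+1).*2.+1 else i./2.
have Ef v w : mix v w \o f =
    mix (mix v (fun i => w i.*2.+1)) (fun i => w i.*2).
  apply: functional_extensionality => i; rewrite /= /f {2}/mix.
  case: ifP => oi; first by rewrite mix_doubleS.
  rewrite {2}/mix; case: ifP => oi'; first by rewrite mix_doubleS.
  by rewrite /mix oi'.
exists (map (@ren L f) S) => v; split=> [[w /SP[w' sw]]|[w /sats_ren]].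
  exists (mix w' w); apply/sats_ren; rewrite Ef.
  by rewrite mix_even mix_odd.
by rewrite Ef => h; exists (fun i => w i.*2.+1); apply/SP; eexists; exact: h.
Qed.

Lemma definable_ex_scons P :
  definable P -> definable (fun v => exists x, P (scons x v)).
Proof.
move=> dP; pose f i := if i is j.+1 then j.*2 else 1.
have Ef v w : mix v w \o f = scons (w 0) v.
  by apply: functional_extensionality => -[|i] //=; rewrite mix_double.
apply: definable_iff (definable_exs (definable_ren f dP)) => v; split.
  by case=> w; rewrite Ef => h; exists (w 0).
by case=> x h; exists (fun=> x); rewrite Ef.
Qed.

Lemma definable_ex (R : dom L -> (nat -> dom L) -> Prop) :
  definable (fun u => R (u 0) (fun i => u i.+1)) ->
  definable (fun v => exists x, R x v).
Proof. by move/definable_ex_scons. Qed.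

(** A whole valuation can be quantified at once, since a finite system mentions only finitely many
    of its entries. This serves to quantify the families of numbers in a [history]. *)
Lemma definable_ex_block (R : (nat -> dom L) -> (nat -> dom L) -> Prop) :
  definable (fun u => R (fun i => u i.*2.+1) (fun i => u i.*2)) ->
  definable (fun v => exists w, R w v).
Proof.
move=> dR; apply: definable_iff (definable_exs dR) => v.
by split=> -[w h]; exists w; rewrite mix_even mix_odd in h *.
Qed.

(** The bound is a fixed number, not a variable, so the quantifier is a finite conjunction. *)
Lemma definable_all_lt n (P : nat -> (nat -> dom L) -> Prop) :
  (forall i, definable (P i)) -> definable (fun v => forall i, i < n -> P i v).
Proof.
move=> dP; elim: n => [|n IH]; first exact: definable_iff definable_true.
apply: definable_iff (definable_and IH (dP n)) => v.
split=> [[h hn] i|h].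
  by rewrite ltnS leq_eqVlt => /orP[/eqP->|/h].
by split=> [i /ltnW/h|]; last exact: h.
Qed.

End Definability.

Arguments definable : clear implicits.

(** Witnesses found in the target need not be encodings, hence the asymmetry: every solution of [Q]
    must decode to a solution of the atom, while only encoded solutions have to satisfy [Q].
    Accordingly [P'] is specified on encoded valuations only. *)
Lemma definable_transfer (L1 L2 : language) (enc : dom L1 -> dom L2)
    (dec : dom L2 -> dom L1) :
  cancel enc dec ->
  (forall c : atom L1, exists Q, [/\ definable L2 Q,
     forall X, Q X -> sat (dec \o X) c & forall v, sat v c -> Q (enc \o v)]) ->
  forall P, definable L1 P ->
  exists2 P', definable L2 P' & forall v, P' (enc \o v) <-> P v.
Proof.
move=> encK tr P [S SP].
have [Q [dQ Q1 Q2]] : exists Q, [/\ definable L2 Q,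
    forall X, Q X -> sats (dec \o X) S & forall v, sats v S -> Q (enc \o v)].
  elim: S {SP} => [|c S [Q [dQ Q1 Q2]]].
    by exists (fun=> True); split=> //; exact: definable_true.
  have [Qc [dQc Qc1 Qc2]] := tr c.
  exists (fun X => Qc X /\ Q X); split=> /=; first exact: definable_and.
    by move=> X [/Qc1 ? /Q1].
  by move=> v [/Qc2 ? /Q2].
exists (fun v => exists w, Q (mix v w)); first exact: definable_exs.
move=> v; rewrite SP; split=> -[w].
  move/Q1 => h; exists (dec \o w); congr (sats _ _): h.
  apply: functional_extensionality => i; rewrite /mix /=.
  by case: ifP => // _; rewrite encK.
move/Q2 => h; exists (enc \o w); congr Q: h.
by apply: functional_extensionality => i; rewrite /mix /=; case: ifP.
Qed.

(** * Systems of ring equations *)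

Inductive ring_atom := IsOne of nat | IsSum of nat & nat & nat
  | IsProd of nat & nat & nat.

Arguments IsOne i%_N.
Arguments IsSum (i j k)%_N.
Arguments IsProd (i j k)%_N.

Section RingLanguage.
Local Open Scope ring_scope.
Variable D : comPzSemiRingType.

Definition ring_sat (X : nat -> D) c : Prop :=
  match c with
  | IsOne i => X i = 1
  | IsSum i j k => X i + X j = X k
  | IsProd i j k => X i * X j = X k
  end.

Definition ring_ren f c :=
  match c with
  | IsOne i => IsOne (f i)
  | IsSum i j k => IsSum (f i) (f j) (f k)
  | IsProd i j k => IsProd (f i) (f j) (f k)
  end.

Fact ring_sat_ren f X c : ring_sat X (ring_ren f c) <-> ring_sat (X \o f) c.
Proof. by case: c. Qed.

Definition ring_language := Language ring_sat_ren.

Local Notation defn := (definable ring_language).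
Implicit Types f g : (nat -> D) -> D.

Definition dfun f := defn (fun u => u 0%N = f (fun i => u i.+1)).

(** Equality of two variables is not an atom; it is expressed as multiplication by a variable equal
    to 1. *)
Lemma dfun_var i : dfun (fun v => v i).
Proof.
have h : defn (fun v => exists o, o = 1 /\ o * v 0%N = v i.+1).
  apply: definable_ex; apply: definable_and;
    first exact: (@definable_atom ring_language (IsOne 0)).
  exact: (@definable_atom ring_language (IsProd 0 1 i.+2)).
apply: definable_iff h => v; split=> [[o [-> ]]|->]; first by rewrite mul1r.
by exists 1; rewrite mul1r.
Qed.

Lemma dfun_ren s f : dfun f -> dfun (fun v => f (fun i => v (s i))).
Proof.
by move/(definable_ren (fun i => if i is j.+1 then (s j).+1 else 0)).
Qed.

(** Naming the value of [f] by an existential variable allows terms inside relations, so that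
    definability can follow the syntax of a formula. *)
Lemma definable_let (R : D -> (nat -> D) -> Prop) f :
  dfun f -> defn (fun u => R (u 0%N) (fun i => u i.+1)) ->
  defn (fun v => R (f v) v).
Proof.
move=> df dR.
have h : defn (fun v => exists x, x = f v /\ R x v).
  by apply: definable_ex; exact: definable_and df dR.
apply: definable_iff h => v.
by split=> [[x [-> ]]|h] //; exists (f v).
Qed.

Lemma definable_rel1 (R : D -> Prop) f :
  defn (fun v => R (v 0%N)) -> dfun f -> defn (fun v => R (f v)).
Proof. by move=> dR df; apply: (@definable_let (fun x v => R x)). Qed.

Lemma definable_rel2 (R : D -> D -> Prop) f g :
  defn (fun v => R (v 0%N) (v 1%N)) -> dfun f -> dfun g ->
  defn (fun v => R (f v) (g v)).
Proof.
move=> dR df dg; apply: (@definable_let (fun x v => R x (g v))) => //.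
apply: (@definable_let (fun x v => R (v 0%N) x)); first exact: (dfun_ren succn dg).
exact: (definable_ren (fun i => if i is 0 then 1 else 0)%N dR).
Qed.

Lemma definable_eq f g : dfun f -> dfun g -> defn (fun v => f v = g v).
Proof.
move=> df dg; exact: (@definable_let (fun x v => x = g v)).
Qed.

Lemma dfun_one : dfun (fun=> 1).
Proof. exact: (@definable_atom ring_language (IsOne 0)). Qed.

Lemma definable_rel3 (R : D -> D -> D -> Prop) f g h :
  defn (fun v => R (v 0%N) (v 1%N) (v 2%N)) -> dfun f -> dfun g -> dfun h ->
  defn (fun v => R (f v) (g v) (h v)).
Proof.
move=> dR df dg dh; apply: (@definable_let (fun x v => R x (g v) (h v))) => //.
apply: (@definable_let (fun x v => R (v 0%N) x (h (fun i => v i.+1)))).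
  exact: (dfun_ren succn dg).
apply: (@definable_let (fun x v => R (v 1%N) (v 0%N) x)).
  exact: (dfun_ren (fun i => i.+2) dh).
exact: (definable_ren (fun i => if i is 0 then 2 else if i is 1 then 1 else 0)%N dR).
Qed.

Lemma dfun_graph1 (F : D -> D) f :
  defn (fun v => v 0%N = F (v 1%N)) -> dfun f -> dfun (fun v => F (f v)).
Proof.
move=> dF df; apply: (@definable_rel2 (fun x y => x = F y)) => //.
  exact: dfun_var.
exact: (dfun_ren succn df).
Qed.

Lemma dfun_graph2 (F : D -> D -> D) f g :
  defn (fun v => v 0%N = F (v 1%N) (v 2%N)) -> dfun f -> dfun g ->
  dfun (fun v => F (f v) (g v)).
Proof.
move=> dF df dg; apply: (@definable_rel3 (fun x y z => x = F y z)) => //.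
- exact: dfun_var.
- exact: (dfun_ren succn df).
- exact: (dfun_ren succn dg).
Qed.

Lemma dfunD f g : dfun f -> dfun g -> dfun (fun v => f v + g v).
Proof.
apply: dfun_graph2; apply: definable_iff (@definable_atom ring_language (IsSum 1 2
  0)) => v /=.
by split=> ->.
Qed.

Lemma dfunM f g : dfun f -> dfun g -> dfun (fun v => f v * g v).
Proof.
apply: dfun_graph2; apply: definable_iff (@definable_atom ring_language (IsProd 1 2
  0)) => v /=.
by split=> ->.
Qed.

End RingLanguage.

(** * Diophantine sets of natural numbers *)

Notation dioph := (definable (ring_language nat)).
Notation diophfun := (@dfun nat).

Section Diophantine.
Implicit Types f g h : (nat -> nat) -> nat.

Lemma dioph_add f g : diophfun f -> diophfun g -> diophfun (fun v => f v + g v).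
Proof. exact: dfunD. Qed.

Lemma dioph_mul f g : diophfun f -> diophfun g -> diophfun (fun v => f v * g v).
Proof. exact: dfunM. Qed.

Lemma dioph_const c : diophfun (fun=> c).
Proof.
elim: c => [|c IH].
  apply: definable_iff (@definable_atom (ring_language nat) (IsSum 0 0 0)) => v.
  by rewrite /= /GRing.add /=; split; lia.
by rewrite -addn1; apply: dioph_add => //; exact: dfun_one.
Qed.

Lemma dioph_succ f : diophfun f -> diophfun (fun v => (f v).+1).
Proof.
move=> df; have -> : (fun v => (f v).+1) = (fun v => f v + 1).
  by apply: functional_extensionality => v; rewrite addn1.
by apply: dioph_add => //; exact: dioph_const.
Qed.

Lemma dioph_ren s f : diophfun f -> diophfun (fun v => f (fun i => v (s i))).
Proof. exact: dfun_ren. Qed.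

Lemma dioph_leq f g : diophfun f -> diophfun g -> dioph (fun v => f v <= g v).
Proof.
apply: (@definable_rel2 nat (fun x y : nat => x <= y)).
have h : dioph (fun v => exists x, v 0 + x = v 1).
  apply: definable_ex; exact: (@definable_atom (ring_language nat) (IsSum 1 0 2)).
apply: definable_iff h => v; split=> [[x <-]|]; first exact: leq_addr.
by exists (v 1 - v 0); rewrite subnKC.
Qed.

Lemma dioph_ltn f g : diophfun f -> diophfun g -> dioph (fun v => f v < g v).
Proof. by move=> df dg; apply: dioph_leq => //; exact: dioph_succ. Qed.

Lemma dioph_sum (I : Type) (r : seq I) (F : I -> (nat -> nat) -> nat) :
  (forall i, diophfun (F i)) -> diophfun (fun v => \sum_(i <- r) F i v).
Proof.
move=> dF; elim: r => [|i r IH].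
  have -> : (fun v => \sum_(i <- [::]) F i v) = fun=> 0.
    by apply: functional_extensionality => v; rewrite big_nil.
  exact: dioph_const.
have -> : (fun v => \sum_(j <- i :: r) F j v) = fun v => F i v + \sum_(j <- r) F j v.
  by apply: functional_extensionality => v; rewrite big_cons.
exact: dioph_add.
Qed.

End Diophantine.

(** A hook, redefined after each new closure property so that [dio] can use it. *)
Ltac dio_extra := fail.
Ltac dio_step := cbv beta; first
  [ assumption
  | exact: dfun_var
  | exact: dioph_const
  | apply: dioph_add | apply: dioph_mul | apply: dioph_succ | apply: dioph_sum => ?
  | dio_extra
  | apply: definable_and | apply: definable_ex
  | apply: dioph_ltn | apply: dioph_leq
  | apply: definable_all_lt => ?
  | apply: definable_eq ].
Ltac dio := repeat dio_step.

Lemma dioph_dvdn f g : diophfun f -> diophfun g -> dioph (fun v => f v %| g v).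
Proof.
apply: (@definable_rel2 nat (fun x y : nat => x %| y)).
have h : dioph (fun v => exists q, v 1 = q * v 0) by dio.
by apply: definable_iff h => v; split=> [[q ->]|/dvdnP]; rewrite ?dvdn_mull.
Qed.

Lemma dioph_eqmod f g h : diophfun f -> diophfun g -> diophfun h ->
  dioph (fun v => f v = g v %[mod h v]).
Proof.
apply: (@definable_rel3 nat (fun x y z : nat => x = y %[mod z])).
have H : dioph (fun v => exists p q, v 0 + p * v 2 = v 1 + q * v 2) by dio.
apply: definable_iff H => v; split=> [[p [q e]]|e].
  by have := congr1 (modn^~ (v 2)) e; rewrite ![_ + _ * _]addnC !modnMDl.
exists (v 1 %/ v 2), (v 0 %/ v 2).
by rewrite {1}(divn_eq (v 0) (v 2)) {2}(divn_eq (v 1) (v 2)) e; lia.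
Qed.

Ltac dio_extra ::= first [apply: dioph_dvdn | apply: dioph_eqmod].

(** * Pell equations *)

Section Pell.
Local Open Scope ring_scope.

Lemma dvdz_leq_abs (d m : int) : (d %| m)%Z -> m != 0 -> (`|d| <= `|m|)%N.
Proof. by rewrite dvdzE => h m0; rewrite dvdn_leq // absz_gt0. Qed.

Lemma dvdzB (d m n : int) : (d %| m)%Z -> (d %| n)%Z -> (d %| m - n)%Z.
Proof. exact: rpredB. Qed.

(** The coordinates of the [n]th power of a + sqrt(d), where d = a^2 - 1, in the basis 1,
    sqrt(d). *)
Fixpoint pellXY (a : int) (n : nat) : int * int :=
  if n is m.+1 then
    let: (x, y) := pellXY a m in (a * x + (a ^+ 2 - 1) * y, x + a * y)
  else (1, 0).

Definition pellX a n := (pellXY a n).1.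
Definition pellY a n := (pellXY a n).2.

Lemma pellXS a n : pellX a n.+1 = a * pellX a n + (a ^+ 2 - 1) * pellY a n.
Proof. by rewrite /pellX /pellY /=; case: (pellXY a n). Qed.

Lemma pellYS a n : pellY a n.+1 = pellX a n + a * pellY a n.
Proof. by rewrite /pellX /pellY /=; case: (pellXY a n). Qed.

Lemma pell_eq a n : pellX a n ^+ 2 - (a ^+ 2 - 1) * pellY a n ^+ 2 = 1.
Proof.
elim: n => [|n IH]; first by rewrite /pellX /pellY /=; ring.
by rewrite -[RHS]IH pellXS pellYS; ring.
Qed.

Lemma pell_add a m n :
  pellX a (m + n) = pellX a m * pellX a n + (a ^+ 2 - 1) * (pellY a m * pellY a n) /\
  pellY a (m + n) = pellX a m * pellY a n + pellY a m * pellX a n.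
Proof.
elim: m => [|m [IHx IHy]]; first by rewrite /pellX /pellY add0n /=; split; ring.
by rewrite addSn !pellXS !pellYS IHx IHy; split; ring.
Qed.

Lemma pellXD a m n :
  pellX a (m + n) = pellX a m * pellX a n + (a ^+ 2 - 1) * (pellY a m * pellY a n).
Proof. by case: (pell_add a m n). Qed.

Lemma pellYD a m n :
  pellY a (m + n) = pellX a m * pellY a n + pellY a m * pellX a n.
Proof. by case: (pell_add a m n). Qed.

(** Modulo a - 1 the recursion becomes that of a = 1, whose solution is X = 1, Y = n. This reads an
    index off a solution. *)
Lemma pellY_mod a n : (a - 1 %| pellY a n - n%:Z)%Z.
Proof.
suff [/dvdzP[p hp] /dvdzP[q hq]] :
  (a - 1 %| pellX a n - 1)%Z /\ (a - 1 %| pellY a n - n%:Z)%Z by rewrite hq dvdz_mull.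
elim: n => [|n [/dvdzP[p hp] /dvdzP[q hq]]].
  by rewrite /pellX /pellY /= !subrr dvdz0.
have hx : pellX a n = p * (a - 1) + 1 by rewrite -hp; ring.
have hy : pellY a n = q * (a - 1) + n%:Z by rewrite -hq; ring.
split; apply/dvdzP.
  exists (a * p + 1 + (a + 1) * pellY a n).
  by rewrite pellXS hx; ring.
exists (p + a * q + n%:Z).
by rewrite pellYS hx hy -[n.+1]addn1 PoszD; ring.
Qed.

Lemma pell_base_mod a b m n : (m %| a - b)%Z ->
  (m %| pellX a n - pellX b n)%Z /\ (m %| pellY a n - pellY b n)%Z.
Proof.
move=> /dvdzP[e he]; have -> : a = b + e * m by rewrite -he; ring.
elim: n => [|n [/dvdzP[p hp] /dvdzP[q hq]]].
  by rewrite /pellX /pellY /= !subrr dvdz0.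
move: hp hq; set x := pellX (b + _) n; set y := pellY (b + _) n => hp hq.
have hx : x = p * m + pellX b n by rewrite -hp; ring.
have hy : y = q * m + pellY b n by rewrite -hq; ring.
split; apply/dvdzP.
  exists (b * p + e * x + q * (b ^+ 2 - 1) + (e * 2 * b + e ^+ 2 * m) * y).
  by rewrite !pellXS -/x -/y hx hy; ring.
exists (p + b * q + e * y).
by rewrite !pellYS -/x -/y hx hy; ring.
Qed.

(** For this modulus (a - k)^2 is congruent to a^2 - 1, so k - a plays the role of sqrt(a^2 - 1),
    and the [n]th power of a + sqrt(a^2 - 1) becomes k^n. *)
Lemma pell_expr_mod a k n :
  (2 * a * k - k ^+ 2 - 1 %| pellX a n - pellY a n * (a - k) - k ^+ n)%Z.
Proof.
elim: n => [|n /dvdzP[q hq]].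
  by rewrite /pellX /pellY /= mul0r subr0 expr0 subrr dvdz0.
apply/dvdzP; exists (k * q + pellY a n).
have -> : k ^+ n.+1 = k * (pellX a n - pellY a n * (a - k) - q * (2 * a * k - k ^+ 2
  - 1)).
  by rewrite exprS -hq; ring.
by rewrite pellXS pellYS; ring.
Qed.

(** * Solutions for a fixed base a > 1: growth, divisibility, congruences *)

Section Base.
Variable a : int.
Hypothesis a_gt1 : 1 < a.
Local Notation X := (pellX a).
Local Notation Y := (pellY a).
Local Notation d := (a ^+ 2 - 1).

Lemma pell_pos n : 0 < X n /\ 0 <= Y n.
Proof.
elim: n => [|n [hx hy]]; first by rewrite /pellX /pellY.
by rewrite pellXS pellYS; split; nia.
Qed.

Lemma pellX_gt0 n : 0 < X n. Proof. by case: (pell_pos n). Qed.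
Lemma pellY_ge0 n : 0 <= Y n. Proof. by case: (pell_pos n). Qed.

Lemma pellY_ltS n : Y n < Y n.+1.
Proof. by have := pellX_gt0 n; have := pellY_ge0 n; rewrite pellYS; nia. Qed.


Lemma pellX_ltS n : X n < X n.+1.
Proof. by have := pellX_gt0 n; have := pellY_ge0 n; rewrite pellXS; nia. Qed.

Lemma pellY_mono m n : (pellY a m <= pellY a n) = (m <= n)%N.
Proof. exact: (Order.NatMonotonyTheory.incnP pellY_ltS). Qed.

Lemma pellX_mono m n : (pellX a m <= pellX a n) = (m <= n)%N.
Proof. exact: (Order.NatMonotonyTheory.incnP pellX_ltS). Qed.

Lemma pellX_inj : injective X.
Proof. by move=> m n e; apply/eqP; rewrite eqn_leq -!pellX_mono e lexx. Qed.

Lemma leq_pellY n : n%:Z <= Y n.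
Proof. by elim: n => // n IH; have := pellY_ltS n; lia. Qed.

Lemma pellX_expr n : a ^+ n <= X n.
Proof.
elim: n => [|n IH]; first by rewrite expr0 /pellX.
by rewrite exprS pellXS; have := pellY_ge0 n; nia.
Qed.

(** Descent: dividing by the fundamental solution a + sqrt(d) gives the nonnegative solution (x',
    y') with a smaller second coordinate. *)
Lemma pell_complete (x y : nat) : x%:Z ^+ 2 - d * y%:Z ^+ 2 = 1 ->
  exists n, x%:Z = X n /\ y%:Z = Y n.
Proof.
elim/ltn_ind: y x => y IH x e.
case: (posnP y) => [y0|y0].
  exists 0%N; rewrite /pellX /pellY /= y0; split=> //.
  by move: e; rewrite y0; nia.
pose x' := a * x%:Z - d * y%:Z; pose y' := a * y%:Z - x%:Z.
have e' : x' ^+ 2 - d * y' ^+ 2 = 1 by rewrite -[RHS]e /x' /y'; ring.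
have y'0 : 0 <= y' by rewrite /y'; nia.
have y'y : y' < y%:Z by rewrite /y'; nia.
have x'0 : 0 <= x' by rewrite /x'; nia.
have [] := IH `|y'|%N _ `|x'|%N; first by lia.
  by rewrite !gez0_abs.
move=> n; rewrite !gez0_abs // => -[hx hy]; exists n.+1.
by rewrite pellXS pellYS -hx -hy /x' /y'; split; ring.
Qed.

Lemma pell_coprime n : coprimez (X n) (Y n).
Proof.
have e : X n * X n + - (d * Y n) * Y n = 1.
  by rewrite -[RHS](pell_eq a n); ring.
by apply/coprimezP; exists (X n, - (d * Y n)).
Qed.

(** The binomial expansion of the [k]th power of X_n + Y_n sqrt(d), taken modulo Y_n and Y_n^2. The
    factor [X n] in the second part avoids the exponent k - 1. *)
Lemma pell_muln n k : (Y n %| X (n * k) - X n ^+ k)%Z /\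
  (Y n ^+ 2 %| Y (n * k) * X n - k%:Z * X n ^+ k * Y n)%Z.
Proof.
elim: k => [|k [/dvdzP[p hp] /dvdzP[q hq]]].
  by rewrite muln0 /pellX /pellY /= expr0 subrr !mul0r subrr !dvdz0.
have hx : X (n * k) = X n ^+ k + p * Y n by rewrite -hp; ring.
have hy : Y (n * k) * X n = k%:Z * X n ^+ k * Y n + q * Y n ^+ 2.
  by rewrite -hq; ring.
rewrite mulnS addnC pellXD pellYD; split; apply/dvdzP.
  by exists (p * X n + d * Y (n * k)); rewrite hx [_ ^+ k.+1]exprS; ring.
exists (p * X n + q * X n).
rewrite mulrDl -[_ * _ * X n]mulrA [Y n * _]mulrC mulrA.
have -> : Y (n * k) * X n * X n = (k%:Z * X n ^+ k * Y n + q * Y n ^+ 2) * X n.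
  by rewrite -hy.
by rewrite hx [_ ^+ k.+1]exprS -[k.+1]addn1 PoszD; ring.
Qed.

Lemma pellY_dvd_muln n k : (Y n %| Y (n * k))%Z.
Proof.
elim: k => [|k IH]; first by rewrite muln0 {2}/pellY /= dvdz0.
by rewrite mulnS pellYD rpredD //; [rewrite dvdz_mull|rewrite dvdz_mulr].
Qed.

(** For m = qn + r, the addition formula and the coprimality of X and Y leave Y_n dividing Y_r with
    r < n; growth then forces Y_r = 0, so r = 0. *)
Lemma pellY_dvd n m : (0 < n)%N -> (Y n %| Y m)%Z -> (n %| m)%N.
Proof.
move=> n0; rewrite {1}(divn_eq m n) addnC pellYD mulnC.
rewrite rpredDl; last by rewrite dvdz_mull // pellY_dvd_muln.
have co : coprimez (Y n) (X (n * (m %/ n))).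
  have := pell_coprime (n * (m %/ n)); rewrite coprimez_sym.
  exact/coprimez_dvdl/pellY_dvd_muln.
rewrite mulrC Gauss_dvdzr // => h.
have r0 : Y (m %% n) = 0.
  case: (eqVneq (Y (m %% n)) 0) => // ne.
  have : Y n <= Y (m %% n).
    by have := dvdz_leq_abs h ne; have := pellY_ge0 n; have := pellY_ge0 (m %% n); lia.
  by rewrite pellY_mono leqNgt ltn_pmod.
have := leq_pellY (m %% n); rewrite r0 /dvdn; lia.
Qed.

(** For m = nk, [pell_muln] turns divisibility by Y_n^2 into divisibility of k X_n^k by Y_n, hence
    of k. *)
Lemma pellY_sqr_dvd n m :
  (0 < n)%N -> (Y n ^+ 2 %| Y m)%Z -> (`|Y n|%N %| m)%N.
Proof.
move=> n0 h; have /dvdnP[k em] : (n %| m)%N.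
  by apply: pellY_dvd => //; apply: dvdz_trans h; rewrite expr2 dvdz_mulr.
have Y0 : Y n != 0 by have := leq_pellY n; lia.
move: h; rewrite em mulnC => h.
have /dvdzP[q hq] := (pell_muln n k).2; have /dvdzP[r hr] := h.
have : (Y n %| k%:Z * X n ^+ k)%Z.
  apply/dvdzP; exists (r * X n - q); apply: (mulIf Y0).
  have -> : k%:Z * X n ^+ k * Y n = Y (n * k) * X n - q * Y n ^+ 2 by rewrite -hq; ring.
  by rewrite hr; ring.
rewrite mulrC Gauss_dvdzr; last first.
  by rewrite coprimez_sym; apply: coprimezXl; exact: pell_coprime.
by rewrite dvdzE /= => h'; rewrite dvdn_mull.
Qed.

(** Modulo X_n, X_2n is -1 and Y_2n is 0, so shifting the index by 2n changes the sign. *)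
Lemma pellX_add2n n j : (X n %| X (n.*2 + j) + X j)%Z.
Proof.
rewrite -addnn !(pellXD, pellYD); apply/dvdzP.
exists (X n * X j + d * Y n * Y j + d * Y n * Y j + X n * X j).
rewrite -[Z in _ + Z = _]mul1r -[Z in _ + Z * _ = _](pell_eq a n); ring.
Qed.

Lemma pellX_sub2n n j : (j <= n.*2)%N -> (X n %| X (n.*2 - j) + X j)%Z.
Proof.
move=> jn; set m := (_ - j)%N; have e : (n.*2 = m + j)%N by rewrite subnK.
have Xm : X m = X n.*2 * X j - d * (Y n.*2 * Y j).
  by rewrite e pellXD pellYD -[LHS]mulr1 -[Z in _ * Z = _](pell_eq a j); ring.
apply/dvdzP; exists (2 * X n * X j - 2 * d * Y n * Y j).
rewrite Xm -addnn pellXD pellYD.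
rewrite -[Z in _ + Z = _]mul1r -[Z in _ + Z * _ = _](pell_eq a n); ring.
Qed.

Lemma pellX_add4n n j q : (X n %| X (q * (4 * n) + j) - X j)%Z.
Proof.
elim: q => [|q IH]; first by rewrite mul0n add0n subrr dvdz0.
have := pellX_add2n n (n.*2 + (q * (4 * n) + j)).
have := pellX_add2n n (q * (4 * n) + j).
have -> : (n.*2 + (n.*2 + (q * (4 * n) + j)) = q.+1 * (4 * n) + j)%N by lia.
move=> /dvdzP[u hu] /dvdzP[v hv]; have /dvdzP[w hw] := IH.
apply/dvdzP; exists (v - u + w).
have -> : X (q.+1 * (4 * n) + j) - X j =
 (X (q.+1 * (4 * n) + j) + X (n.*2 + (q * (4 * n) + j))) -
 (X (n.*2 + (q * (4 * n) + j)) + X (q * (4 * n) + j)) + (X (q * (4 * n) + j) - X j)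
   by ring.
by rewrite hv hu hw; ring.
Qed.

Lemma pellX_mod_inj n i r : (0 < i < n)%N -> (r <= n)%N ->
  (X n %| X r - X i)%Z -> r = i.
Proof.
move=> /andP[i0 in_] rn h; apply: pellX_inj; apply/eqP; rewrite -subr_eq0.
case: eqVneq => // ne; have := dvdz_leq_abs h ne.
have : X r <= X n by rewrite pellX_mono.
have : X i <= X n by rewrite pellX_mono ltnW.
have := pellX_gt0 i; have := pellX_gt0 r; have := pellX_gt0 n; lia.
Qed.

(** From index 1 on, X more than doubles at each step, so the sum of two earlier terms stays below
    X_n; for r = n, X_n would have to divide the smaller X_i. *)
Lemma pellX_mod_opp n i r : (0 < i < n)%N -> (r <= n)%N ->
  ~ (X n %| X r + X i)%Z.
Proof.
move=> /andP[i0 ln]; case: n ln => // n ln.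
have hi : X i <= X n by rewrite pellX_mono.
have X0 := pellX_gt0; have hn : 2 * X n < X n.+1.
  rewrite pellXS; have := X0 n; have := leq_pellY n; nia.
rewrite leq_eqVlt => /orP[/eqP->|rn] h.
  have : (X n.+1 %| X i)%Z by move: h; rewrite rpredDl ?dvdzz.
  move=> /dvdz_leq_abs; have := X0 i; have := X0 n; have := X0 n.+1; lia.
have hr : X r <= X n by rewrite pellX_mono.
have := dvdz_leq_abs h; have := X0 i; have := X0 r; have := X0 n; lia.
Qed.

(** A congruence between values determines the index up to sign modulo 4n, because X has period 4n
    modulo X_n and is symmetric within a period. *)
Lemma pellX_mod_index n i j : (0 < i < n)%N -> (X n %| X j - X i)%Z ->
  (4 * n %| j + i)%N \/ j = i %[mod 4 * n].
Proof.
move=> lin; rewrite (divn_eq j (4 * n)).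
have n0 : (0 < n)%N by case/andP: lin => _; exact: leq_ltn_trans.
have : (j %% (4 * n) < 4 * n)%N by rewrite ltn_pmod // muln_gt0.
set q := (j %/ _)%N; set r := (j %% _)%N => rn h.
have {}h : (X n %| X r - X i)%Z.
  by have := dvdzB h (pellX_add4n n r q); congr is_true; congr (_ %| _)%Z; ring.
have opp k : (k <= n)%N -> (X n %| X r + X k)%Z -> False.
  move=> kn hk; apply: (pellX_mod_opp lin kn).
  by have := dvdzB hk h; congr is_true; congr (_ %| _)%Z; ring.
have pos k : (k <= n)%N -> (X n %| X r - X k)%Z -> k = i.
  move=> kn hk; apply: (pellX_mod_inj lin kn).
  by have := dvdzB h hk; congr is_true; congr (_ %| _)%Z; ring.
(* On the four quarters of a period X_r is congruent to X_r, -X_(2n-r), -X_(r-2n) and X_(4n-r); the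
   two negative quarters contradict [opp]. *)
case: (leqP r n) => rn1; first by right; rewrite (pos r) // ?subrr ?dvdz0 // modnMDl.
case: (leqP r n.*2) => rn2.
  case: (opp (n.*2 - r)%N); first by lia.
  by have := pellX_sub2n rn2; rewrite addrC.
case: (leqP r (n + n.*2)) => rn3.
  case: (opp (r - n.*2)%N); first by lia.
  by have := pellX_add2n n (r - n.*2); rewrite subnKC // ltnW.
left; suff <- : (4 * n - r = i)%N.
  have -> : (q * (4 * n) + r + (4 * n - r) = q.+1 * (4 * n))%N by lia.
  by apply/dvdnP; exists q.+1.
apply: pos; first by lia.
have h1 : (X n %| X (n.*2 - (4 * n - r)) + X (4 * n - r))%Z by apply: pellX_sub2n; lia.
have := pellX_add2n n (r - n.*2); rewrite subnKC; last by lia.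
move: h1; have -> : (n.*2 - (4 * n - r) = r - n.*2)%N by lia.
by move=> h1 h2; have := dvdzB h2 h1; congr is_true; congr (_ %| _)%Z; ring.
Qed.

End Base.
End Pell.

(** * Exponentiation is Diophantine *)

(* The base is shifted by two, so that no side condition [1 < a] is needed. *)
Definition natX (a n : nat) : nat := `|pellX (Posz a.+2) n|%N.
Definition natY (a n : nat) : nat := `|pellY (Posz a.+2) n|%N.

Lemma natXE a n : Posz (natX a n) = pellX (Posz a.+2) n.
Proof. by rewrite /natX gez0_abs // ltW // pellX_gt0. Qed.

Lemma natYE a n : Posz (natY a n) = pellY (Posz a.+2) n.
Proof. by rewrite /natY gez0_abs // pellY_ge0. Qed.

Lemma nat_pell_eq a n :
  natX a n * natX a n = a.+1 * a.+3 * (natY a n * natY a n) + 1.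
Proof.
have e := pell_eq (Posz a.+2) n; rewrite -natXE -natYE in e.
by nia.
Qed.

Lemma nat_pell_complete a x y :
  x * x = a.+1 * a.+3 * (y * y) + 1 -> exists n, x = natX a n /\ y = natY a n.
Proof.
move=> e; have [||n [hx hy]] := @pell_complete (Posz a.+2) _ x y => //; first by nia.
by exists n; rewrite /natX /natY -hx -hy.
Qed.

Lemma natY_mono a m n : (natY a m <= natY a n) = (m <= n).
Proof. by rewrite -lez_nat !natYE pellY_mono. Qed.

Lemma natY_lt a m n : (natY a m < natY a n) = (m < n).
Proof. by rewrite !ltnNge natY_mono. Qed.

Lemma leq_natY a n : n <= natY a n.
Proof. by rewrite -lez_nat natYE leq_pellY. Qed.

Lemma eqn_mod_dvdz (a b m : nat) :
  a = b %[mod m] <-> (Posz m %| (Posz a - Posz b)%R)%Z.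
Proof.
by rewrite -eqz_mod_dvd !modz_nat eqz_nat; split=> /eqP.
Qed.

Lemma natX_gt0 a n : 0 < natX a n.
Proof. by rewrite -ltz_nat natXE pellX_gt0. Qed.

Lemma coprime_natXY a n : coprime (natX a n) (natY a n).
Proof. by have := pell_coprime (Posz a.+2) n; rewrite -natXE -natYE. Qed.

Lemma natY_base_mod a b m n :
  a = b %[mod m] -> natX a n = natX b n %[mod m] /\ natY a n = natY b n %[mod m].
Proof.
move=> /eqn_mod_dvdz h.
have {}h : (Posz m %| (Posz a.+2 - Posz b.+2)%R)%Z.
  by congr (is_true (_ %| _)%Z): h; lia.
by split; apply/eqn_mod_dvdz; rewrite !(natXE, natYE); case: (pell_base_mod n h).
Qed.

Lemma natY_mod a n : natY a n = n %[mod a.+1].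
Proof.
apply/eqn_mod_dvdz; rewrite natYE; have := pellY_mod (Posz a.+2) n.
by congr (is_true (_ %| _)%Z); lia.
Qed.

Lemma natY_sqr_dvdn a n : natY a n * natY a n %| natY a (n * natY a n).
Proof.
have [_ h] := pell_muln (Posz a.+2) n (natY a n).
set D := (pellY (Posz a.+2) n ^+ 2)%R in h.
have : (D %| (pellY (Posz a.+2) (n * natY a n)%N * pellX (Posz a.+2) n)%R)%Z.
  have h2 : (D %| (pellX (Posz a.+2) n ^+ natY a n * D)%R)%Z by exact: dvdz_mull.
  by have := rpredD h h2; rewrite /D natYE; congr (is_true (_ %| _)%Z); ring.
rewrite Gauss_dvdzl; last first.
  by rewrite coprimez_sym coprimezXr // pell_coprime.
by rewrite -!natYE dvdzE abszX /= expnS expn1.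
Qed.

Lemma natY_dvdn_mul a n k : natY a n %| natY a (n * k).
Proof. by have := pellY_dvd_muln (Posz a.+2) n k; rewrite -!natYE. Qed.

Lemma natY_double a n : natY a n.*2 = 2 * natX a n * natY a n.
Proof.
apply/eqP; rewrite -eqz_nat !PoszM natXE !natYE -addnn pellYD.
by apply/eqP; ring.
Qed.

(** The products [a.+1 * a.+3] are a.+2 squared minus 1. Let i, n, j be the indices of (x, y), (u,
    v), (s, t). As b.+2 is a.+2 modulo u, s = x gives X_j = X_i modulo X_n, so j is i or -i modulo
    4n, hence modulo 4y, since y * y dividing v makes y divide n. As b.+2 is 1 modulo 4y, t is
    congruent both to j and to k. Finally k and i are at most y, which leaves k = i. *)
Definition pell_system (a k x y : nat) : Prop := exists u v s t b : nat,
  x * x = a.+1 * a.+3 * (y * y) + 1 /\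
  u * u = a.+1 * a.+3 * (v * v) + 1 /\
  s * s = b.+1 * b.+3 * (t * t) + 1 /\
  b.+2 = 1 %[mod 4 * y] /\ b.+2 = a.+2 %[mod u] /\
  y * y %| v /\ y < v /\
  s = x %[mod u] /\ t = k %[mod 4 * y] /\ k <= y.

Lemma pell_system_sound a k x y :
  0 < k -> pell_system a k x y -> x = natX a k /\ y = natY a k.
Proof.
move=> k0 [u [v [s [t [b [+ [+ [+ [b1 [ba [yv [ltyv [sx [tk ky]]]]]]]]]]]]]].
move=> /nat_pell_complete[i [ex ey]] /nat_pell_complete[n [eu ev]].
move=> /nat_pell_complete[j [es et]].
have i0 : 0 < i by case: i ex ey ky => // _ -> ; rewrite leqNgt k0.
have ltin : i < n by rewrite -(natY_lt a) -ey -ev.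
have yn : y %| n.
  have := @pellY_sqr_dvd (Posz a.+2) isT i n i0; rewrite -!natYE -ey -ev; apply.
  by rewrite dvdzE abszX /= expnS expn1.
have h1 : natX a j = natX a i %[mod u].

  have /(@natY_base_mod _ _ _ j)[h _] : b = a %[mod u].
    by apply/eqP; rewrite -(eqn_modDr 2) !addn2; apply/eqP.
  by rewrite -h -es sx ex.
have kj : j = k %[mod 4 * y].
  rewrite -tk et; have := natY_mod b j.
  move/eqn_mod_dvdz => h; apply/esym/eqn_mod_dvdz; apply: dvdz_trans h.
  by move/eqn_mod_dvdz: b1; congr (is_true (_ %| _)%Z); lia.
have iy : i <= y by rewrite ey leq_natY.
suff ki : k = i by rewrite ki.
have h2 : (pellX (Posz a.+2) n %| (pellX (Posz a.+2) j - pellX (Posz a.+2) i)%R)%Z.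
  by move/eqn_mod_dvdz: h1; rewrite eu !natXE.
have lin : 0 < i < n by rewrite i0.
case: (pellX_mod_index _ lin h2) => //.
- move=> h; have {h} : 4 * y %| j + i by apply: dvdn_trans h; rewrite dvdn_mul.
  rewrite /dvdn -modnDml kj modnDml -/(dvdn _ _) => h.
  have ki0 : 0 < k + i by rewrite addn_gt0 k0.
  by move: (dvdn_leq ki0 h) ky iy k0; clear; lia.
- move=> h; have {}h : j = i %[mod 4 * y].
    apply/eqn_mod_dvdz; move/eqn_mod_dvdz: h; apply: dvdz_trans.
    by rewrite dvdzE /= dvdn_mul.
  by move: kj; rewrite h !modn_small //; move: ky iy k0; clear; lia.
Qed.

Lemma pell_system_complete a k :
  0 < k -> pell_system a k (natX a k) (natY a k).
Proof.
(* The factor k * y makes y^2 divide v; doubling the index makes v even, so u, which is coprime to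
   v, is coprime to 4y. *)
move=> k0; set y := natY a k; pose n := (k * y).*2.
have y0 : 0 < y by apply: leq_trans (leq_natY a k).
pose u := natX a n; pose v := natY a n.
have u0 : 0 < u by exact: natX_gt0.
have yv : y * y %| v.
  apply: dvdn_trans (natY_sqr_dvdn a k) _.
  by rewrite /v /n -muln2 natY_dvdn_mul.
have cu : coprime (4 * y) u.
  have cuv : coprime u v := coprime_natXY a n.
  rewrite coprime_sym coprimeMr; apply/andP; split.
    have : coprime u 2.
      by apply: coprime_dvdr cuv; rewrite /v /n natY_double -mulnA dvdn_mulr.
    by move=> c2; rewrite -[4]/(2 * 2) coprimeMr c2.
  by apply: coprime_dvdr cuv; apply: dvdn_trans yv; rewrite dvdn_mulr.
(* The added multiple of both moduli only ensures B > 1, so that B is of the form b.+2. *)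
pose B := chinese (4 * y) u 1 a.+2 + 2 * (4 * y * u).
have B1 : B = 1 %[mod 4 * y].
  by rewrite /B addnC [4 * y * u]mulnC mulnA modnMDl chinese_modl.
have B2 : B = a.+2 %[mod u].
  by rewrite /B addnC mulnA modnMDl chinese_modr.
have B_gt1 : 1 < B.
  have : 0 < y * u by rewrite muln_gt0 y0.
  by rewrite /B -mulnA; move: (chinese _ _ _ _) (y * u) => c z; clear; lia.
have eB : B = B.-2.+2 by move: B_gt1; clear; lia.
exists u, v, (natX B.-2 k), (natY B.-2 k), B.-2.
do !split; try exact: nat_pell_eq; rewrite -?eB //.
- rewrite natY_lt /n; move: y0 k0; clear; nia.
- suff h : B.-2 = a %[mod u] by case: (natY_base_mod k h).
  by apply/eqP; rewrite -(eqn_modDr 2) !addn2 -eB B2.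
- have := natY_mod B.-2 k; move/eqn_mod_dvdz => h; apply/eqn_mod_dvdz;
  apply: dvdz_trans h.
  by move/eqn_mod_dvdz: B1; congr (is_true (_ %| _)%Z); lia.
- exact: leq_natY.
Qed.


Lemma dioph_natX f g : diophfun f -> diophfun g ->
  diophfun (fun v => natX (f v) (g v).+1).
Proof.
apply: (@dfun_graph2 nat (fun a k => natX a k.+1)).
have H : dioph (fun v => exists y, pell_system (v 1) (v 2).+1 (v 0) y).
  by rewrite /pell_system; dio.
apply: definable_iff H => v; split=> [[y /pell_system_sound[]//]|->].
by exists (natY (v 1) (v 2).+1); exact: pell_system_complete.
Qed.

Lemma dioph_natY f g : diophfun f -> diophfun g ->
  diophfun (fun v => natY (f v) (g v).+1).
Proof.
apply: (@dfun_graph2 nat (fun a k => natY a k.+1)).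
have H : dioph (fun v => exists x, pell_system (v 1) (v 2).+1 x (v 0)) by rewrite
  /pell_system; dio.
apply: definable_iff H => v; split=> [[y /pell_system_sound[]//]|->].
by exists (natX (v 1) (v 2).+1); exact: pell_system_complete.
Qed.

Ltac dio_extra ::= first [apply: dioph_dvdn | apply: dioph_eqmod
  | apply: dioph_natX | apply: dioph_natY].

Lemma Posz_expn m n : Posz (m ^ n) = (Posz m ^+ n)%R.
Proof. by elim: n => // n IH; rewrite expnS PoszM IH exprS. Qed.

(** [M] is the modulus of [pell_expr_mod] with all terms moved to avoid subtraction. The base must
    be large enough that N^(k+1) < M; it is itself taken to be a Pell value, which already grows
    exponentially. *)
Definition expn_system (N k m : nat) : Prop := exists a e M : nat,
  a.+2 = natX (N + k) (N + k).+1 /\ a.+2 = N + e /\ M + N * N + 1 = 2 * a.+2 * N /\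
  m < M /\ natX a k.+1 = natY a k.+1 * e + m %[mod M].

Lemma expn_systemP (N k m : nat) : 0 < N -> expn_system N k m <-> m = N ^ k.+1.
Proof.
move=> N0.
have big : (N + k).+2 ^ (N + k).+1 <= natX (N + k) (N + k).+1.
  by rewrite -lez_nat natXE Posz_expn pellX_expr.
have N1 : N.+2 <= (N + k).+2 ^ (N + k).+1.
  apply: leq_trans (_ : (N + k).+2 ^ 1 <= _); first by rewrite expn1; lia.
  by rewrite leq_pexp2l.
have N2 : N ^ k.+1 < (N + k).+2 ^ (N + k).+1.
  apply: leq_trans (_ : (N + k).+2 ^ k.+1 <= _).
    by rewrite ltn_exp2r //; lia.
  by rewrite leq_pexp2l //; lia.
have main a e M : a.+2 = natX (N + k) (N + k).+1 -> a.+2 = N + e ->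
    M + N * N + 1 = 2 * a.+2 * N ->
    N ^ k.+1 < M /\ natX a k.+1 = natY a k.+1 * e + N ^ k.+1 %[mod M].
  move=> ha he hM; split; first by nia.
  apply/eqn_mod_dvdz; have := pell_expr_mod (Posz a.+2) (Posz N) k.+1.
  rewrite PoszD PoszM -natXE -natYE.
  rewrite Posz_expn.
  have -> : (2 * Posz a.+2 * Posz N - Posz N ^+ 2 - 1 = Posz M)%R by lia.
  by congr (is_true (_ %| _)%Z); lia.
split=> [[a [e [M [ha [he [hM [mM hm]]]]]]]|->].
  have [h1 h2] := main _ _ _ ha he hM; move: hm; rewrite h2 => /eqP.
  by rewrite eqn_modDl !modn_small // => /eqP.
have [a ha] : exists a, a.+2 = natX (N + k) (N + k).+1.
  by exists (natX (N + k) (N + k).+1).-2; lia.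
exists a, (a.+2 - N), (2 * a.+2 * N - N * N - 1).
have he : a.+2 = N + (a.+2 - N) by lia.
have hM : (2 * a.+2 * N - N * N - 1) + N * N + 1 = 2 * a.+2 * N by nia.
by have [] := main _ _ _ ha he hM.
Qed.

(** Pell indices are definable only when positive, so the system defines the next power, and the
    value sought is multiplied by the positive base. *)
Lemma dioph_expn f g : diophfun f -> diophfun g ->
  diophfun (fun v => (f v).+1 ^ g v).
Proof.
apply: (@dfun_graph2 nat (fun n k => n.+1 ^ k)).
have H : dioph (fun v => expn_system (v 1).+1 (v 2) (v 0 * (v 1).+1)).
  by rewrite /expn_system; dio.
apply: definable_iff H => v; rewrite expn_systemP // expnSr.
by split=> [/eqP|->//]; rewrite eqn_pmul2r // => /eqP.
Qed.

Ltac dio_extra ::= first [apply: dioph_dvdn | apply: dioph_eqmod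
  | apply: dioph_expn].

(** * Binomial coefficients are Diophantine *)

Lemma ltn_sum_digits u k (c : nat -> nat) :
  0 < u -> (forall i, c i < u) -> \sum_(0 <= i < k) c i * u ^ i < u ^ k.
Proof.
move=> u0 cu; elim: k => [|k IH]; first by rewrite big_geq.
rewrite big_nat_recr //= expnS; have := cu k.
by move: IH; move: (\sum_(0 <= i < k) _) (u ^ k) (c k) => s p d; clear; nia.
Qed.

Lemma leq_bin_expn n i : 'C(n, i) <= 2 ^ n.
Proof.
elim: n i => [|n IH] [|i] //; first by rewrite bin0 expn_gt0.
by rewrite binS expnS mul2n -addnn leq_add.
Qed.

(** In base u = 2^n + 1, which exceeds every C(n, i), the digits of (u + 1)^n are the binomial
    coefficients. *)
Lemma bin_digit n k : exists hi lo,
  (2 ^ n).+2 ^ n = hi * (2 ^ n).+1 ^ k.+1 + 'C(n, k) * (2 ^ n).+1 ^ k + lo /\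
  lo < (2 ^ n).+1 ^ k.
Proof.
set u := (2 ^ n).+1.
have cu i : 'C(n, i) < u by rewrite ltnS leq_bin_expn.
(* The sum is padded with zero terms so that a digit at position [k] exists even when k > n. *)
have -> : (2 ^ n).+2 ^ n = \sum_(0 <= i < k.+1 + n) 'C(n, i) * u ^ i.
  rewrite -/u -addn1 addnC expnDn -(big_mkord xpredT (fun i => 'C(n, i) * (1 ^ (n -
    i) * u ^ i))).
  have -> : k.+1 + n = n.+1 + k by lia.
  rewrite [RHS](big_cat_nat (leq0n n.+1)) ?leq_addr //= [X in _ = _ + X]big_nat [X in
    _ = _ + X]big1 ?addn0.
    by apply: eq_bigr => i _; rewrite exp1n mul1n.
  by move=> i /andP[li _]; rewrite bin_small.
rewrite (big_cat_nat (leq0n k)) /=; last by rewrite addSn leqW // leq_addr.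
rewrite [X in _ + X]big_ltn; last by rewrite addSn ltnS leq_addr.
have /dvdnP[hi ehi] : u ^ k.+1 %| \sum_(k.+1 <= i < k.+1 + n) 'C(n, i) * u ^ i.
  rewrite big_nat; apply: dvdn_sum => i /andP[ki _].
  by rewrite dvdn_mull // dvdn_exp2l.
exists hi, (\sum_(0 <= i < k) 'C(n, i) * u ^ i); rewrite ehi; split; first by lia.
exact: ltn_sum_digits.
Qed.

Definition bin_system n k c := exists hi lo,
  (2 ^ n).+2 ^ n = hi * (2 ^ n).+1 ^ k.+1 + c * (2 ^ n).+1 ^ k + lo /\
  lo < (2 ^ n).+1 ^ k /\ c < (2 ^ n).+1.

Lemma bin_systemP n k c : bin_system n k c <-> c = 'C(n, k).
Proof.
have [hi [lo [e llo]]] := bin_digit n k.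
have hC : 'C(n, k) < (2 ^ n).+1 by rewrite ltnS leq_bin_expn.
split=> [[hi' [lo' [+ [llo' hc]]]]|->]; last by exists hi, lo.
rewrite e !expnS !mulnA -!mulnDl; set u := (2 ^ n).+1 in hc hC llo llo' *.
have u0 : 0 < u ^ k by rewrite expn_gt0.
move=> /(congr1 (divn^~ (u ^ k))); rewrite !divnMDl // !divn_small // !addn0.
by move=> /(congr1 (modn^~ u)); rewrite !modnMDl !modn_small.
Qed.

Lemma dioph_bin f g : diophfun f -> diophfun g ->
  diophfun (fun v => 'C(f v, g v)).
Proof.
apply: (@dfun_graph2 nat (fun n k => 'C(n, k))).
have H : dioph (fun v => bin_system (v 1) (v 2) (v 0)).
  by rewrite /bin_system; dio.
by apply: definable_iff H => v; exact: bin_systemP.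
Qed.

(** * Binary masking *)

(* By Lucas' theorem, every binary digit of [x] is at most that of [y]. *)
Definition masked (x y : nat) : bool := odd 'C(y, x).

Lemma dioph_masked f g : diophfun f -> diophfun g ->
  dioph (fun v => masked (f v) (g v)).
Proof.
move=> df dg; have H : dioph (fun v => exists q, 'C(g v, f v) = q * 2 + 1).
  apply: definable_ex; apply: definable_eq; last by dio.
  by apply: dioph_bin; [exact: (dioph_ren succn dg)|exact: (dioph_ren succn df)].
apply: definable_iff H => v; rewrite /masked; split=> [[q ->]|o].
  by rewrite oddD oddM andbF.
by exists 'C(g v, f v)./2; rewrite -{1}[LHS]odd_double_half o addnC muln2.
Qed.

(** The last-digit step of Lucas' theorem for the prime 2: C(2n, 2m+1) is even, and the other three
    cases have the parity of C(n, m). Pascal's rule gives it by induction on n. *)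
Lemma masked_bit (b c : bool) m n :
  masked (c + m.*2) (b + n.*2) = (c <= b) && masked m n.
Proof.
rewrite /masked; elim: n m b c => [|n IH] m b c.
  case: m => [|m]; first by case: b; case: c.
  by rewrite bin_small ?andbF //; case: b; case: c; rewrite /= ?andbF //; lia.
have I1 k : odd 'C(n.*2.+1, k.*2) = odd 'C(n, k).
  by have := IH k true false; rewrite add0n add1n.
have I2 k : odd 'C(n.*2.+1, k.*2.+1) = odd 'C(n, k).
  by have := IH k true true; rewrite !add1n.
have E2 k : odd 'C(n.*2.+2, k.*2.+1) = false by rewrite binS oddD I2 I1 addbb.
have E1 k : odd 'C(n.*2.+2, k.*2) = odd 'C(n.+1, k).
  case: k => [|k]; first by rewrite !bin0.
  by rewrite doubleS binS oddD -doubleS I1 I2 [in RHS]binS oddD.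
rewrite doubleS; case: b; case: c; rewrite ?add1n ?add0n ?E1 ?E2 //.
  by rewrite binS oddD E2 E1.
case: m => [|m]; first by rewrite !bin0.
by rewrite doubleS binS oddD -(doubleS m) E1 E2 addbF.
Qed.

Lemma masked_leq x y : masked x y -> x <= y.
Proof. by rewrite /masked; case: leqP => // h; rewrite bin_small. Qed.

Lemma masked_digit c x y X Y : x < 2 ^ c -> y < 2 ^ c ->
  masked (x + 2 ^ c * X) (y + 2 ^ c * Y) = masked x y && masked X Y.
Proof.
elim: c x y => [|c IH] x y; first by rewrite expn0 !ltnS !leqn0 => /eqP-> /eqP->;
  rewrite !mul1n.
rewrite expnS mul2n => hx hy.
rewrite -[x]odd_double_half -[y]odd_double_half -!addnA -!doubleMl -!doubleD.
rewrite !masked_bit IH ?andbA //; first by lia.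
by lia.
Qed.

Lemma masked_small c x : x < 2 ^ c -> masked x (2 ^ c).-1.
Proof.
elim: c x => [|c IH] x; first by rewrite expn0 ltnS leqn0 => /eqP->.
rewrite expnS mul2n => hx.
have -> : (2 ^ c).*2.-1 = true + ((2 ^ c).-1).*2 by have := expn_gt0 2 c; lia.
rewrite -[x]odd_double_half masked_bit IH; last by lia.
by case: (odd x).
Qed.

Lemma masked0 y : masked 0 y. Proof. by rewrite /masked bin0. Qed.

(** * Register machines *)

(** The number with [s] digits 1 in base [Q]: a mark at every time of the run. *)
Fixpoint geo (Q s : nat) : nat := if s is s'.+1 then 1 + Q * geo Q s' else 0.

Lemma geoE Q s : Q * geo Q s + 1 = geo Q s + Q ^ s.
Proof.
elim: s => [|s IH] /=; first by rewrite muln0.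
by rewrite expnS; nia.
Qed.

Lemma geo_unique Q s I : 1 < Q -> Q * I + 1 = I + Q ^ s -> I = geo Q s.
Proof. by move=> Q1 e; have := geoE Q s; nia. Qed.

Lemma digit_inj Q a b A B : a < Q -> b < Q ->
  a + Q * A = b + Q * B -> a = b /\ A = B.
Proof.
move=> aQ bQ e; have Q0 : 0 < Q by case: Q aQ {bQ e}.
have := congr1 (modn^~ Q) e; have := congr1 (divn^~ Q) e.
by rewrite ![_ + Q * _]addnC ![Q * _]mulnC !modnMDl !divnMDl // !divn_small //
  !modn_small // !addn0.
Qed.

Lemma sum_digit n Q (w X Y : nat -> nat) :
  \sum_(i < n) w i * (X i + Q * Y i) =
  \sum_(i < n) w i * X i + Q * \sum_(i < n) w i * Y i.
Proof.
by rewrite big_distrr -big_split; apply: eq_bigr => i _ /=; rewrite mulnDr mulnCA.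
Qed.

Lemma sum_single n p (w X : nat -> nat) : p < n -> (forall i, i < n -> i != p -> X i
  = 0) ->
  \sum_(i < n) w i * X i = w p * X p.
Proof.
move=> pn X0; rewrite (bigD1 (Ordinal pn)) //= big1 ?addn0 // => i ne.
by rewrite X0 ?muln0.
Qed.

Lemma sum_eq1 n (X : nat -> nat) : \sum_(i < n) X i = 1 ->
  exists p, [/\ p < n, X p = 1 & forall i, i < n -> i != p -> X i = 0].
Proof.
elim: n => [|n IH]; first by rewrite big_ord0.
rewrite big_ord_recr /= => e; case: (eqVneq (X n) 0) => Xn.
  have [|p [pn Xp X0]] := IH; first by rewrite -e Xn addn0.
  exists p; split=> //; first exact: ltnW.
  by move=> i; rewrite ltnS leq_eqVlt => /orP[/eqP->|/X0//].
exists n; split=> //.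
  by move: (\sum_(i < n) X i) e Xn => S e; lia.
have /eqP : \sum_(i < n) X i = 0 by move: (\sum_(i < n) X i) e Xn => S e; lia.
rewrite sum_nat_eq0 => /forallP h i; rewrite ltnS leq_eqVlt => /orP[->//|lin] _.
exact/eqP/(h (Ordinal lin)).
Qed.

Section Simulation.
Variables (M : machine) (K : nat).
Local Notation N := (size M).

Definition incr r i : nat := if onth M i is Some (Inc r') then r' == r else 0.
Definition decr r i : nat := if onth M i is Some (Dec r' _) then r' == r else 0.
Definition isdec i : nat := if onth M i is Some (Dec _ _) then 1 else 0.
Definition target i : nat := if onth M i is Some (Dec _ p) then p else 0.

(* The time [s] run of the machine is recorded by the base [Q] digits of
   the following numbers: the digit [t] of [E i] (resp. [Z i]) is 1 if
   instruction [i] is executed at time [t] without (resp. with) a jump, the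
   digit [t] of [R r] is the content of register [r] at time [t], and the digit
   [t] of [A r] is 0 if [r] is successfully tested for zero at time [t].  The
   run leads from [(pc, v)] to [(f, g)]. *)
Definition history (Q h s I pc f : nat) (v g E Z R A : nat -> nat) : Prop :=
  (forall i, i < N -> masked (E i) I /\ masked (Z i) (isdec i * I)) /\
  \sum_(i < N) 1 * (E i) + \sum_(i < N) 1 * (Z i) = I /\
  \sum_(i < N) i * E i + \sum_(i < N) i * Z i + f * Q ^ s =
    pc + Q * (\sum_(i < N) i.+1 * E i + \sum_(i < N) target i * Z i) /\
  (forall r, r < K ->
    R r + g r * Q ^ s + Q * \sum_(i < N) decr r i * E i =
      v r + Q * (R r + \sum_(i < N) incr r i * E i) /\
    A r + \sum_(i < N) decr r i * Z i = I /\
    masked (A r) I /\ masked (R r) (h * A r)).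

Hypothesis regs_lt : forall i r, (incr r i + decr r i = 1) -> r < K.

Lemma masked_const Q w x y X Y c : Q = 2 ^ c.+1 -> x < Q -> w * y < Q ->
  masked (x + Q * X) (w * (y + Q * Y)) = masked x (w * y) && masked X (w * Y).
Proof. by move=> -> xQ yQ; rewrite mulnDr [w * (_ * _)]mulnCA masked_digit. Qed.

Lemma masked01 x : masked x 1 -> x = 0 \/ x = 1.
Proof. by move/masked_leq; case: x => [|[|]]; auto. Qed.

Lemma leq_masked x y : x <= y <= 1 -> masked x y.
Proof. by case: y x => [|[|y]] [|[|x]] // /andP[]. Qed.

Lemma isdec_le1 i : isdec i <= 1.
Proof. by rewrite /isdec; case: onth => [[]|]. Qed.

(** Induction from the front: the first step supplies the lowest digit of every number, and the
    history of the remaining run is shifted by one digit. Contents below 2^c leave the top bit of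
    each digit clear. *)
Lemma history_complete c s pc v :
  (forall t, t < s -> (iter t (step M) (pc, v)).1 < N) ->
  (forall t r, t < s -> r < K -> (iter t (step M) (pc, v)).2 r < 2 ^ c) ->
  let c' := iter s (step M) (pc, v) in
  exists E Z R A, history (2 ^ c.+1) (2 ^ c).-1 s (geo (2 ^ c.+1) s) pc c'.1 v c'.2 E
    Z R A.
Proof.
set Q := 2 ^ c.+1.
elim: s pc v => [|s IH] pc v pcN vc /=.
  exists (fun=> 0), (fun=> 0), (fun=> 0), (fun=> 0).
  have S0 (w : nat -> nat) : \sum_(i < N) w i * 0 = 0.
    by rewrite big1 // => i _; rewrite muln0.
  rewrite /history !S0 (S0 (fun=> 1)) !muln0 !expn0 !muln1 !add0n addn0.
  split=> [i _|]; first by rewrite !masked0.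
  by do !split; rewrite ?S0 ?muln0 ?addn0 ?add0n ?muln1 ?masked0.
have pc_lt : pc < N := pcN 0 isT.
case es : (step M (pc, v)) => [pc' v'].
have [||E [Z [R [A [h1 [h2 [h3 h4]]]]]]] := IH pc' v'.
- by move=> t ts; have := pcN t.+1 ts; rewrite iterSr es.
- by move=> t r ts; have := vc t.+1 r ts; rewrite iterSr es.
rewrite -/(iter s.+1 _ _) iterSr es; set fin := iter s _ _ in h3 h4 *.
(* [z] is 1 when the first step is a jump, [e] when it is not. *)
pose z : nat := if onth M pc is Some (Dec r _) then v r == 0 else 0.
pose e := 1 - z.
have ez : e + z = 1 by rewrite /e /z; case: onth => [[r|r p]|] //; case: (v r == 0).
have zdec : z <= isdec pc by rewrite /z /isdec; case: onth => [[r|r p]|] //;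
  case: (v r == 0).
have epc : pc' = pc.+1 * e + target pc * z.
  move: es; rewrite /e /z /target /=; case: onth (onthTE M pc) => [[r|r p]|] /=.
  - by move=> _ [<- _]; lia.
  - by move=> _; case: (v r) => [|m] [<- _] /=; lia.
  - by rewrite pc_lt.
have ev r : v' r + decr r pc * e = v r + incr r pc * e.
  move: es; rewrite /e /z /decr /incr /=; case: onth => [[r'|r' p]|] /=.
  - by move=> [_ <-]; rewrite /upd [r == r']eq_sym; case: (eqVneq r' r) => [<-|_]; lia.
  - case vr: (v r') => [|m] [_ <-]; rewrite ?muln0 //.
    by rewrite /upd [r == r']eq_sym; case: (eqVneq r' r) => [<-|_]; rewrite ?vr; lia.
  - by move=> [_ <-].
have zv r : decr r pc * z = 1 -> v r = 0.
  rewrite /z /decr; case: onth => [[r'|r' p]|] //.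
  by case: (eqVneq r' r) => [->|_] //; case: (v r).
have dz1 r : decr r pc * z <= 1.
  by rewrite /z /decr; case: onth => [[r'|r' p]|] //; case: (r' == r); case: (v r' == 0).
pose D d i : nat := if i == pc then d else 0.
have Dsum (w : nat -> nat) d : \sum_(i < N) w i * D d i = w pc * d.
  rewrite (@sum_single _ pc) //; first by rewrite /D eqxx.
  by move=> i _ /negbTE ne; rewrite /D ne.
have Q1 : 1 < Q by rewrite /Q expnS; have := expn_gt0 2 c; lia.
exists (fun i => D e i + Q * E i), (fun i => D z i + Q * Z i),
  (fun r => v r + Q * R r), (fun r => (1 - decr r pc * z) + Q * A r).
rewrite /history !sum_digit !Dsum; split=> [i iN|].
  have [hE hZ] := h1 i iN; split.
    rewrite masked_digit //; last by rewrite /D; case: eqP => // _; lia.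
    by rewrite hE andbT /D leq_masked //; case: eqP => // _; lia.
  rewrite (@masked_const Q _ _ _ _ _ c) //.
  - rewrite hZ andbT /D; case: eqP => [->|_]; last exact: masked0.
    by rewrite muln1 leq_masked // zdec isdec_le1.
  - by rewrite /D; case: eqP => // _; lia.
  - by rewrite muln1 (leq_ltn_trans _ Q1) // isdec_le1.
split; first by rewrite !(sum_digit _ _ (fun=> 1)) !(Dsum (fun=> 1)) -h2 /=;
  move: ez; move: (\sum_(i < N) _) (\sum_(i < N) _); clear; nia.
split.
  rewrite !(sum_digit _ _ id) !(Dsum id) expnS;
    move: (congr1 (muln Q) h3) (congr1 (muln pc) ez); rewrite epc -/Q.
  move: (\sum_(i < N) _) (\sum_(i < N) _) (\sum_(i < N) _) (\sum_(i < N) _) (Q ^ s).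
  by clear; nia.
move=> r rK; have [h5 [h6 [h7 h8]]] := h4 r rK.
rewrite !sum_digit !Dsum; split.
  rewrite expnS; move: (congr1 (muln Q) h5) (congr1 (muln Q) (ev r)); rewrite -/Q.
  move: (\sum_(i < N) _) (\sum_(i < N) _) (Q ^ s).
  by clear; nia.
split; first by rewrite -h6; move: (dz1 r); clear; nia.
have A0 : 1 - decr r pc * z < Q by apply: leq_ltn_trans Q1; lia.
have v2 := vc 0 r isT rK; have vQ : v r < Q by rewrite /Q expnS; move: v2 => /=; lia.
split; first by rewrite masked_digit // h7 andbT; move: (dz1 r); case: (_ * z) => [|[|]].
rewrite (@masked_const Q _ _ _ _ _ c) //; last first.
  by apply: leq_ltn_trans (_ : (2 ^ c).-1 * 1 < _);
    rewrite ?leq_mul2l ?leq_subr ?orbT // /Q expnS; lia.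
rewrite h8 andbT; case: (posnP (decr r pc * z)) => [->|d0].
  by rewrite muln1 masked_small.
by rewrite (zv r) ?masked0 //; move: (dz1 r) d0; clear; lia.
Qed.

(** The lowest digit of [A] is 0 or 1, so the mask keeps the top bit of the lowest register digit
    clear; this later excludes a borrow. *)
Lemma masked_mod_le c s A R : masked A (geo (2 ^ c.+1) s) ->
  masked R ((2 ^ c).-1 * A) -> R %% 2 ^ c.+1 <= (2 ^ c).-1.
Proof.
set Q := 2 ^ c.+1; have Q0 : 0 < Q by rewrite expn_gt0.
have Q1 : 1 < Q by rewrite /Q expnS; have := expn_gt0 2 c; lia.
case: s => [|s] /=.
  move=> /masked_leq; rewrite leqn0 => /eqP-> /masked_leq.
  by rewrite muln0 leqn0 => /eqP->; rewrite mod0n.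
have dQ X : X = X %% Q + Q * (X %/ Q) by rewrite {1}(divn_eq X Q) mulnC addnC.
rewrite [A]dQ [R]dQ masked_digit ?ltn_pmod // => /andP[/masked01 A01 _].
rewrite (@masked_const Q _ _ _ _ _ c) ?ltn_pmod //.
  by move=> /andP[/masked_leq + _]; case: A01 => -> h; rewrite -dQ; lia.
by case: A01 => ->; rewrite /Q expnS; have := expn_gt0 2 c; lia.
Qed.

(** Comparing lowest digits in each equation recovers the first step; the quotients by [Q] form a
    history of the rest. The size conditions keep the program counter and contents within one
    digit. *)
Lemma history_sound c s pc f v g E Z R A :
  2 * N < 2 ^ c.+1 -> (forall i, target i < 2 ^ c.+1) -> pc < 2 ^ c.+1 ->
  (forall r, r < K -> v r < 2 ^ c.+1) ->
  history (2 ^ c.+1) (2 ^ c).-1 s (geo (2 ^ c.+1) s) pc f v g E Z R A ->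
  let c' t := iter t (step M) (pc, v) in
  [/\ forall t, t < s -> (c' t).1 < N, (c' s).1 = f &
      forall r, r < K -> (c' s).2 r = g r].
Proof.
set Q := 2 ^ c.+1 => NQ tQ.
have Q1 : 1 < Q by rewrite /Q expnS; have := expn_gt0 2 c; lia.
have Q0 : 0 < Q by exact: ltnW.
elim: s pc v E Z R A => [|s IH] pc v E Z R A pcQ vQ; rewrite /history.
  case=> [h1 [_ [h3 h4]]] /=.
  have E0 i : i < N -> E i = 0.
    by case/h1 => /masked_leq; rewrite leqn0 => /eqP.
  have Z0 i : i < N -> Z i = 0.
    by case/h1 => _ /masked_leq; rewrite muln0 leqn0 => /eqP.
  have S0 (w X : nat -> nat) : (forall i, i < N -> X i = 0) -> \sum_(i < N) w i * X i = 0.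
    by move=> X0; rewrite big1 // => i _; rewrite X0 ?muln0.
  split=> // [|r rK].
    by move: h3; rewrite (S0 id) // (S0 id) // !S0 //= !add0n muln1 muln0 addn0 => ->.
  have [h5 [_ [/masked_leq + /masked_leq]]] := h4 r rK; rewrite leqn0 => /eqP->.
  rewrite muln0 leqn0 => /eqP R0.
  by move: h5; rewrite !S0 // R0 /= !muln0 addn0 add0n muln1 addn0 => ->.
have dQ (X : nat -> nat) : exists X0 X1, (forall i, X0 i < Q) /\ X = fun i => X0 i +
  Q * X1 i.
  exists (fun i => X i %% Q), (fun i => X i %/ Q); split=> [i|]; first exact: ltn_pmod.
  by apply: functional_extensionality => i; rewrite {1}(divn_eq (X i) Q) mulnC addnC.
have [E0 [E1 [E0Q ->]]] := dQ E; have [Z0 [Z1 [Z0Q ->]]] := dQ Z.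
have [R0 [R1 [R0Q ->]]] := dQ R; have [A0 [A1 [A0Q ->]]] := dQ A.
rewrite !(sum_digit _ _ id) !(sum_digit _ _ (fun=> 1)) !(sum_digit _ _ S) !(sum_digit
  _ _ target) expnS.
case=> [h1 [h2 [h3 h4]]].
have {}h1 i : i < N -> [/\ masked (E0 i) 1, masked (E1 i) (geo Q s),
    masked (Z0 i) (isdec i) & masked (Z1 i) (isdec i * geo Q s)].
  move=> iN; have [hE hZ] := h1 i iN; move: hE;
    rewrite /= masked_digit // => /andP[-> ->].
  move: hZ; rewrite /= (@masked_const Q _ _ _ _ _ c) // muln1; last first.
    by rewrite (leq_ltn_trans _ Q1) // isdec_le1.
  by move=> /andP[-> ->].
have E01 i : i < N -> E0 i <= 1 by case/h1 => /masked_leq.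
have Z01 i : i < N -> Z0 i <= isdec i by case/h1 => _ _ /masked_leq.
have {h2} [s1 h2] : \sum_(i < N) (E0 i + Z0 i) = 1 /\
    \sum_(i < N) 1 * E1 i + \sum_(i < N) 1 * Z1 i = geo Q s.
  apply: (@digit_inj Q) => //.
    (* Each instruction contributes at most 2 to this digit, so 2N < Q prevents a carry. *)
    apply: leq_ltn_trans NQ; rewrite mulnC -[N in N * 2]card_ord -sum_nat_const.
    apply: leq_sum => i _; have := E01 i (ltn_ord i); have := Z01 i (ltn_ord i).
    by have := isdec_le1 i; lia.
  move: h2 => /= <-; rewrite big_split /= mulnDr.
  have e1 (X : nat -> nat) : \sum_(i < N) 1 * X i = \sum_(i < N) X i.
    by apply: eq_bigr => i _; rewrite mul1n.
  by rewrite (e1 E0) (e1 Z0); repeat move: (\sum_(i < N) _); clear; lia.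
have [p [pN p1 pz]] := @sum_eq1 _ (fun i => E0 i + Z0 i) s1.
have ES (w : nat -> nat) : \sum_(i < N) w i * E0 i = w p * E0 p.
  by apply: sum_single => // i iN ne; have := pz i iN ne; lia.
have ZS (w : nat -> nat) : \sum_(i < N) w i * Z0 i = w p * Z0 p.
  by apply: sum_single => // i iN ne; have := pz i iN ne; lia.
move: h3; rewrite (ES id) (ZS id) (ES S) (ZS target) => h3.
have {h3} [epc h3] : p = pc /\ \sum_(i < N) i * E1 i + \sum_(i < N) i * Z1 i + f * Q ^ s =
    (p.+1 * E0 p + target p * Z0 p) + Q * (\sum_(i < N) i.+1 * E1 i + \sum_(i < N)
      target i * Z1 i).
  apply: (@digit_inj Q) => //; first by apply: ltn_trans pN _; lia.
  move: h3 (congr1 (muln p) p1).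
  move: (\sum_(i < N) _) (\sum_(i < N) _) (\sum_(i < N) _) (\sum_(i < N) _) (Q ^ s).
  by clear; lia.
subst p.
have {}h4 r : r < K -> [/\ R0 r = v r,
   R1 r + g r * Q ^ s + (decr r pc * E0 pc + Q * \sum_(i < N) decr r i * E1 i) =
     R0 r + incr r pc * E0 pc + Q * (R1 r + \sum_(i < N) incr r i * E1 i),
   A0 r + decr r pc * Z0 pc = 1, A1 r + \sum_(i < N) decr r i * Z1 i = geo Q s &
   [/\ masked (A1 r) (geo Q s), masked (R0 r) ((2 ^ c).-1 * A0 r) & masked (R1 r) ((2
     ^ c).-1 * A1 r)]].
  move=> rK; have := h4 r rK; rewrite !sum_digit !ES !ZS => -[h5 [h6 [h7 h8]]].
  have d1 : decr r pc <= 1 by rewrite /decr; case: onth => [[|r' ?]|] //; case: (r' == r).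
  move: h7; rewrite /= masked_digit // => /andP[/masked_leq A01 A1m].
  move: h8; rewrite /= (@masked_const Q _ _ _ _ _ c) //; last first.
    apply: leq_ltn_trans (_ : (2 ^ c).-1 * 1 < _);
      rewrite ?leq_mul2l ?A01 ?orbT // /Q expnS.
    by have := expn_gt0 2 c; lia.
  move=> /andP[R0m R1m].
  have [h61 h62] : A0 r + decr r pc * Z0 pc = 1 /\
      A1 r + \sum_(i < N) decr r i * Z1 i = geo Q s.
    case/h1: pN => _ _ /masked_leq; have := isdec_le1 pc => id1 z1 _.
    have dz : decr r pc * Z0 pc <= 1 by rewrite -[1]/(1 * 1) leq_mul // (leq_trans z1).
    have e6 : (A0 r + decr r pc * Z0 pc) + Q * (A1 r + \sum_(i < N) decr r i * Z1 i)
      = 1 + Q * geo Q s.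
      by move: h6 => /= <-; repeat move: (\sum_(i < N) _); clear; lia.
    have o1 : A0 r + decr r pc * Z0 pc = 1.
      have := congr1 (modn^~ Q) e6;
        rewrite ![_ + Q * _]addnC ![Q * _]mulnC !modnMDl (modn_small Q1).
      move: dz A01 Q1; case: (A0 r) => [|[|?]] //; case: (_ * Z0 _) => [|[|?]] //;
        rewrite ?mod0n // => _ _.
      by case: (Q) => [|[|[|?]]].
    split=> //; move: e6; rewrite o1 => /addnI/eqP; rewrite eqn_pmul2l // => /eqP.
    done.
  have [h51 h52] : R0 r = v r /\
    R1 r + g r * Q ^ s + (decr r pc * E0 pc + Q * \sum_(i < N) decr r i * E1 i) =
     R0 r + incr r pc * E0 pc + Q * (R1 r + \sum_(i < N) incr r i * E1 i).
    apply: (@digit_inj Q) => //; first exact: vQ.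
    move: h5; repeat move: (\sum_(i < N) _); clear; lia.
  by split.
have z_le : Z0 pc <= isdec pc by exact: Z01.
have [pc' [v' [es epc' ev']]] : exists pc' v', [/\ step M (pc, v) = (pc', v'),
    pc' = pc.+1 * E0 pc + target pc * Z0 pc &
    forall r, v' r + decr r pc * E0 pc = v r + incr r pc * E0 pc].
  rewrite /step; case eM: (onth M pc) (onthTE M pc) => [[r0|r0 p]|] => [_|_|];
    last by rewrite pN.
    have z0 : Z0 pc = 0 by move: z_le; rewrite /isdec eM leqn0 => /eqP.
    have e1 : E0 pc = 1 by move: p1; rewrite z0 addn0.
    exists pc.+1, (upd v r0 (v r0).+1); rewrite z0 e1 !muln1 muln0 addn0; split=> // r.
    by rewrite /upd /decr /incr eM [r == r0]eq_sym; case: (eqVneq r0 r) => [->|_]; lia.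
  have d0 : decr r0 pc = 1 by rewrite /decr eM eqxx.
  have i0 : incr r0 pc = 0 by rewrite /incr eM.
  have r0K : r0 < K by apply: (@regs_lt pc); rewrite d0 i0.
  have [h51 h52 h61 h62 [A1m R0m R1m]] := h4 r0 r0K.
  have tp : target pc = p by rewrite /target eM.
  have inc0 r : incr r pc = 0 by rewrite /incr eM.
  case: (posnP (Z0 pc)) => z0.
    have e1 : E0 pc = 1 by move: p1; rewrite z0 addn0.
    case vr: (v r0) => [|m].
      (* Decrementing an empty register would make the next digit Q - 1, whose top bit is set; after
         the last step no natural number g r0 fits. *)
      exfalso; move: h52; rewrite h51 vr d0 i0 e1 !add0n muln1.
      move: (masked_mod_le A1m R1m); rewrite -/Q.
      case: (s) A1m h1 => [|s'] A1m h1'.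
        have -> : R1 r0 = 0.
          move: A1m R1m => /masked_leq; rewrite leqn0 => /eqP-> /masked_leq.
          by rewrite muln0 leqn0 => /eqP.
        rewrite [X in _ = Q * (_ + X)]big1 ?muln0; first by lia.
        by move=> i _; case: (h1' i (ltn_ord i)) => _ /masked_leq;
          rewrite leqn0 => /eqP-> _ _; rewrite muln0.
      move=> hR e; have : (R1 r0).+1 %% Q = 0.
        have := congr1 (modn^~ Q) e; rewrite modnMr expnS.
        have -> : R1 r0 + g r0 * (Q * Q ^ s') + (1 + Q * \sum_(i < N) decr r0 i * E1 i) =
          (g r0 * Q ^ s' + \sum_(i < N) decr r0 i * E1 i) * Q + (R1 r0).+1.
          by repeat move: (\sum_(i < N) _); move: (Q ^ s'); clear; lia.
        by rewrite modnMDl.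
      rewrite -addn1 -modnDml modn_small; first by lia.
      by apply: leq_ltn_trans (_ : (2 ^ c).-1 + 1 < _);
        rewrite ?leq_add2r // /Q expnS; have := expn_gt0 2 c; lia.
    exists pc.+1, (upd v r0 m); rewrite z0 e1 !muln1 muln0 addn0; split=> // r.
    by rewrite /upd /decr /incr eM [r == r0]eq_sym; case: (eqVneq r0 r) => [<-|_];
      rewrite ?vr; lia.
  have z1 : Z0 pc = 1 by move: z0 p1; case: (Z0 pc) => [|[|?]] //; lia.
  have e0 : E0 pc = 0 by move: p1; rewrite z1; lia.
  (* A jump makes the digit of [A] zero, and the mask then forces the register digit to vanish. *)
  have v0 : v r0 = 0.
    move: h61 R0m; rewrite d0 z1 h51 => h61.
    have -> : A0 r0 = 0 by lia.
    by rewrite muln0 => /masked_leq; rewrite leqn0 => /eqP.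
  exists p, v; rewrite v0 e0 z1 tp !muln0 muln1; split=> // r.
  by rewrite !muln0.
have e01 : E0 pc <= 1 by exact: E01.
have [|||c1 c2 c3] := IH pc' v' E1 Z1 R1 A1.
- case: (posnP (Z0 pc)) => z0.
    by rewrite epc' z0 muln0 addn0; apply: leq_ltn_trans NQ; move: e01 pN; clear; nia.
  have -> : pc' = target pc by rewrite epc'; move: z0 p1;
    case: (Z0 pc) => [|[|?]] //; case: (E0 pc) => [|?] //; lia.
  exact: tQ.
- move=> r rK; have [h51 _ h61 _ [_ /masked_leq R0m _]] := h4 r rK.
  have a1 : A0 r <= 1 by lia.
  have i1 : incr r pc * E0 pc <= 1.
    rewrite -[1]/(1 * 1) leq_mul // /incr; case: onth => [[r'|? ?]|] //;
      by case: (r' == r).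
  have : R0 r <= (2 ^ c).-1 by apply: leq_trans R0m _;
    rewrite -[X in _ <= X]muln1 leq_mul2l a1 orbT.
  have := ev' r; rewrite -h51 /Q expnS; move: (expn_gt0 2 c) i1; clear.
  by move: (2 ^ c) => C; lia.
- split=> [i iN|]; first by case: (h1 i iN).
  split=> //; split; first by rewrite h3 epc'.
  move=> r rK; have [h51 h52 h61 h62 [A1m R0m R1m]] := h4 r rK; split=> //.
  move: h52 (ev' r); rewrite h51; repeat move: (\sum_(i < N) _); move: (Q ^ s);
    clear; lia.
- have cS t : iter t.+1 (step M) (pc, v) = iter t (step M) (pc', v') by rewrite iterSr es.
  by rewrite cS; split=> // -[_|t ts]; rewrite ?cS //; apply: c1.
Qed.

End Simulation.

Ltac dio_extra ::= first [apply: dioph_dvdn | apply: dioph_eqmod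
  | apply: dioph_expn | apply: dioph_masked | apply: definable_ex_block].

(** * Halting computations as a Diophantine relation *)

Lemma step_halted M c : size M <= c.1 -> step M c = c.
Proof.
case: c => pc v /= h; rewrite /step; case: onth (onthTE M pc) => // i.
by rewrite ltnNge h.
Qed.

Lemma iter_step_halted M c s t : size M <= (iter s (step M) c).1 -> s <= t ->
  iter t (step M) c = iter s (step M) c.
Proof.
move=> h; elim: t => [|t IH]; first by rewrite leqn0 => /eqP->.
by rewrite leq_eqVlt => /orP[/eqP->//|/IH e]; rewrite iterS e step_halted.
Qed.

Lemma computes_inj M n m m' : computes M n m -> computes M n m' -> m = m'.
Proof.
move=> [t [ht <-]] [t' [ht' <-]].
by case: (leqP t t') => [|/ltnW] le; rewrite (iter_step_halted _ le).
Qed.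

Definition reg (M : machine) i : nat :=
  match onth M i with Some (Inc r) => r | Some (Dec r _) => r | None => 0 end.

Definition nregs (M : machine) : nat := (\sum_(i < size M) reg M i).+1.

Lemma incr_decr_lt M i r : incr M r i + decr M r i = 1 -> r < nregs M.
Proof.
move=> h; have {h} [e iM] : r = reg M i /\ i < size M.
  rewrite -onthTE; move: h; rewrite /incr /decr /reg.
  by case: onth => [[r'|r' p]|] //=; case: eqVneq => // ->.
by rewrite /nregs ltnS e (bigD1 (Ordinal iM)) //= leq_addr.
Qed.

(** With h + 1 = 2^c, [(h + h).+2] is the base 2^(c+1). The sum of all targets serves as one bound
    for each of them. *)
Lemma computes_history M n m : computes M n m <->
  exists s c f I h, h.+1 = 2 ^ c /\ size M <= f /\ n < (h + h).+2 /\
    2 * size M < (h + h).+2 /\ \sum_(i < size M) target M i < (h + h).+2 /\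
    (h + h).+2 * I + 1 = I + (h + h).+2 ^ s /\
    exists g E Z R A, g 0 = m /\ history M (nregs M) (h + h).+2 h s I 0 f
      (upd (fun=> 0) 0 n) g E Z R A.
Proof.
have tle i B : \sum_(j < size M) target M j < B -> target M i < B.
  apply: leq_ltn_trans; case: (ltnP i (size M)) => iM.
    by rewrite (bigD1 (Ordinal iM)) //= leq_addr.
  by rewrite /target; case: onth (onthTE M i) => //; rewrite ltnNge iM.
pose c0 := (0, upd (fun=> 0) 0 n).
split=> [[t [ht hm]]|[s [c [f [I [h [hc [Mf [nQ [MQ [tQ [hI H]]]]]]]]]]]]; last first.
  have eQ : (h + h).+2 = 2 ^ c.+1 by rewrite expnS -hc; lia.
  case: H => g [E [Z [R [A [<- H]]]]]; rewrite -/c0.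
  have eI : I = geo (h + h).+2 s by apply: geo_unique.
  have eh : h = (2 ^ c).-1 by rewrite -hc.
  rewrite eI eQ eh in H; rewrite eQ in nQ MQ tQ.
  have [|||_ hf hg] := @history_sound M (nregs M) (@incr_decr_lt M) c s 0 f
      (upd (fun=> 0) 0 n) g E Z R A MQ _ _ _ H.
  - by move=> i; exact: tle.
  - by rewrite expn_gt0.
  - by move=> r _; rewrite /upd; case: eqP => // _; rewrite expn_gt0.
  by exists s; rewrite /= -/c0 hf hg.
(* The least halting time is taken, as a history requires the program counter to lie in the program
   at every time before [s]. *)
have [s hs smin] := @ex_minnP (fun s => size M <= (iter s (step M) c0).1) (ex_intro _
  t ht).
(* [B] bounds the input, the program data and every recorded register content; since B < 2^B, the
   exponent c = B suffices. *)
pose B := n + 2 * size M + \sum_(i < size M) target M i +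
  \sum_(j < s) \sum_(r < nregs M) (iter j (step M) c0).2 r.
have Bc : B < 2 ^ B by exact: ltn_expl.
have [||E [Z [R [A H]]]] := @history_complete M (nregs M) B s 0 (upd (fun=> 0) 0 n).
- by move=> j js; rewrite ltnNge; apply/negP => /smin; rewrite leqNgt js.
- move=> j r js rK; apply: leq_ltn_trans Bc; rewrite /B (bigD1 (Ordinal js)) //=.
  rewrite (bigD1 (Ordinal rK)) //= -/c0; apply: leq_trans (leq_addl _ _).
  by rewrite -addnA leq_addr.
have eQ : ((2 ^ B).-1 + (2 ^ B).-1).+2 = 2 ^ B.+1 by rewrite expnS; lia.
exists s, B, (iter s (step M) c0).1, (geo (2 ^ B.+1) s), (2 ^ B).-1.
rewrite eQ; split; first by lia.
split=> //.
have BQ : B < 2 ^ B.+1 by rewrite expnS; lia.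
split; first by move: BQ; rewrite /B; move: (2 ^ _); clear; lia.
split; first by move: BQ; rewrite /B; move: (2 ^ _); clear; lia.
split; first by move: BQ; rewrite /B; move: (2 ^ _); clear; lia.
split; first exact: geoE.
exists (iter s (step M) c0).2, E, Z, R, A; split=> //.
by rewrite -(iter_step_halted hs (smin _ ht)).
Qed.

Lemma dioph_upd0 r f :
  diophfun f -> diophfun (fun v => upd (fun=> 0) 0 (f v) r).
Proof.
by rewrite /upd; case: (r == 0) => // _; exact: dioph_const.
Qed.

Ltac dio_extra ::= first [apply: dioph_dvdn | apply: dioph_eqmod | apply: dioph_expn
  | apply: dioph_masked | apply: dioph_upd0 | apply: definable_ex_block].

Lemma dioph_computes M m f : diophfun f -> dioph (fun v => computes M (f v) m).
Proof.
apply: (@definable_rel1 nat (fun n => computes M n m)).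
apply: definable_iff; first by move=> v; apply: iff_sym; apply: computes_history.
by rewrite /history; dio.
Qed.

(** * Natural numbers among the integers *)

Section FourSquares.
Local Open Scope ring_scope.

(* Rational rather than integral squares: Lagrange's descent is not needed. *)
Definition four_squares (n : nat) : Prop := exists (v : nat) (a b c d : int),
  (0 < v)%N /\ n%:Z * v%:Z ^+ 2 = a ^+ 2 + b ^+ 2 + c ^+ 2 + d ^+ 2.

(** Euler's four-square identity. *)
Lemma four_squares_mul m n :
  four_squares m -> four_squares n -> four_squares (m * n)%N.
Proof.
move=> [v [a [b [c [d [v0 e]]]]]] [v' [a' [b' [c' [d' [v0' e']]]]]].
exists (v * v')%N, (a * a' + b * b' + c * c' + d * d'),
  (a * b' - b * a' + c * d' - d * c'), (a * c' - c * a' + d * b' - b * d'),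
  (a * d' - d * a' + b * c' - c * b').
split; first by rewrite muln_gt0 v0.
have -> : (m * n)%N%:Z * (v * v')%N%:Z ^+ 2 = (m%:Z * v%:Z ^+ 2) * (n%:Z * v'%:Z ^+ 2).
  by rewrite !PoszM; ring.
by rewrite e e'; ring.
Qed.

(** m times mn is m^2 n, and the square m^2 is absorbed by the denominator. *)
Lemma four_squares_div m n :
  (0 < m)%N -> four_squares m -> four_squares (m * n)%N -> four_squares n.
Proof.
move=> m0 hm hmn; have [v [a [b [c [d [v0 e]]]]]] := four_squares_mul hm hmn.
exists (m * v)%N, a, b, c, d; split; first by rewrite muln_gt0 m0.
by rewrite -e !PoszM; ring.
Qed.

Lemma sqr_mod_inj p x y : prime p -> (x <= p./2)%N -> (y <= p./2)%N -> odd p ->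
  (x ^ 2 = y ^ 2 %[mod p])%N -> x = y.
Proof.
move=> pp + + op; wlog le_yx : x y / (y <= x)%N.
  move=> H xp yp e; case: (leqP y x) => h; first exact: H.
  by apply/esym/H => //; exact: ltnW.
move=> xp yp /eqP; rewrite eqn_mod_dvd ?leq_sqr // subn_sqr Euclid_dvdM // => /orP[] h.
  apply/eqP; rewrite eqn_leq le_yx andbT -subn_eq0; apply: contraLR h => ne.
  by rewrite gtnNdvd ?lt0n // ; have := prime_gt0 pp; lia.
case: (posnP (x + y)) => [|xy0]; first by lia.
have := dvdn_leq xy0 h; have := odd_double_half p; rewrite op; lia.
Qed.

(** Pigeonhole: for x, y at most (p - 1)/2 there are p + 1 residues x^2 and -(y^2 + 1), the latter
    written with p^2 added; each kind is injective, so two of different kinds agree. The size of x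
    and y gives m < p. *)
Lemma sum_two_squares_plus1 p : prime p -> odd p ->
  exists x y m, [/\ (x ^ 2 + y ^ 2 + 1 = m * p)%N & (m < p)%N].
Proof.
move=> pp op; have p0 := prime_gt0 pp; have ep := odd_double_half p.
rewrite op /= in ep; have p1 := prime_gt1 pp.
pose h := p./2.
pose f (s : 'I_h.+1 + 'I_h.+1) : 'I_p := Ordinal (ltn_pmod
  (match s with inl x => x ^ 2 | inr y => p ^ 2 - (y ^ 2).+1 end)%N p0).
have yp (y : 'I_h.+1) : ((y ^ 2).+1 <= p ^ 2)%N.
  by rewrite ltn_sqr; have := ltn_ord y; rewrite /h; lia.
have /injectivePn[s [t ne]] : ~~ injectiveb f.
  apply/negP => /injectiveP/leq_card; rewrite card_sum !card_ord /h; lia.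
have inl_inj (x y : 'I_h.+1) : f (inl x) = f (inl y) -> x = y.
  move=> /(congr1 val) /= e; apply/val_inj/(@sqr_mod_inj p) => //.
  - exact: (ltn_ord x).
  - exact: (ltn_ord y).
have add1 (y : 'I_h.+1) : ((p ^ 2 - (y ^ 2).+1) + (y ^ 2).+1 = p ^ 2)%N by rewrite subnK.
have inr_inj (x y : 'I_h.+1) : f (inr x) = f (inr y) -> x = y.
  move=> /(congr1 val) /= /eqP; rewrite -(eqn_modDr ((x ^ 2).+1 + (y ^ 2).+1)).
  rewrite addnA add1 [((x ^ 2).+1 + _)%N]addnC addnA add1 eqn_modDl => /eqP e.
  apply/val_inj/(@sqr_mod_inj p) => //; [exact: (ltn_ord x)|exact: (ltn_ord y)|].
  by apply/eqP; rewrite -(eqn_modDr 1) !addn1; apply/eqP.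
have cross (x y : 'I_h.+1) : f (inl x) = f (inr y) ->
    exists a b m, [/\ (a ^ 2 + b ^ 2 + 1 = m * p)%N & (m < p)%N].
  move=> /(congr1 val) /= /eqP; rewrite -(eqn_modDr (y ^ 2).+1) add1.
  rewrite [(p ^ 2)%N]expnS modnMr => /dvdnP[m em]; exists x, y, m; split; first by lia.
  rewrite -(ltn_pmul2r p0) -em; have := ltn_ord x; have := ltn_ord y; rewrite /h; nia.
case: s t ne => [x|x] [y|y] ne e.
- by case/eqP: ne; rewrite (inl_inj _ _ e).
- exact: (cross x y).
- by apply: (cross y x).
- by case/eqP: ne; rewrite (inr_inj _ _ e).
Qed.

(** Strong induction: composites by multiplicativity; an odd prime p has a multiple mp, 0 < m < p,
    that is a sum of squares, and m is divided out by induction. *)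
Lemma four_squares_all n : four_squares n.
Proof.
elim/ltn_ind: n => n IH; case: (ltnP n 3) => n3.
  exists 1%N, (0 < n)%N%:Z, (1 < n)%N%:Z, 0, 0; split=> //.
  by case: n n3 {IH} => [|[|[|]]].
have n1 : (1 < n)%N by lia.
have [pn|/primePn[|[d /andP[d1 dn] /dvdnP[q en]]]] := boolP (prime n); last 2 first.
- by rewrite ltnNge ltnW.
- rewrite en; apply: four_squares_mul; apply: IH => //.
  by rewrite en; nia.
have on : odd n by case/even_prime: pn => // e; lia.
have [x [y [m [e mn]]]] := sum_two_squares_plus1 pn on.
have m0 : (0 < m)%N by case: m e {mn} => [|//]; rewrite mul0n addn1.
apply: (four_squares_div m0 (IH m mn)); rewrite -e.
exists 1%N, x%:Z, y%:Z, 1, 0; split=> //.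
by rewrite !PoszD -!mulnn !PoszM; ring.
Qed.

(* The second equation says that [v] is nonzero. *)
Definition nonneg_system (z : int) : Prop :=
  exists v a b c d t u w : int,
    z * (v * v) = a * a + (b * b + (c * c + d * d)) /\
    v * t = (u + u + 1) * (w + w + w + 1).

(** (2u + 1)(3w + 1) never vanishes. Conversely, a positive v = 2^k m with m odd divides such a
    number: v 2^k = m 4^k, and 4^k is 1 modulo 3. *)
Lemma nonneg_systemP z : nonneg_system z <-> 0 <= z.
Proof.
split=> [[v [a [b [c [d [t [u [w [e hv]]]]]]]]]|].
  have v0 : v != 0.
    apply/eqP => v0; move: hv; rewrite v0 mul0r => /esym/eqP.
    by rewrite mulf_eq0 => /orP[] /eqP; lia.
  rewrite -(@pmulr_lge0 _ (v * v)); last by rewrite -expr2 exprn_even_gt0.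
  by rewrite e; have := sqr_ge0 a; nia.
case: z => // n _; have [v [a [b [c [d [v0 e]]]]]] := four_squares_all n.
have [m om em] := pfactor_coprime (isT : prime 2) v0; set k := logn 2 v in em.
rewrite coprime2n in om.
have [w hw] : exists w, (2 ^ k * 2 ^ k = w + w + w + 1)%N.
  elim: (k) => [|k' [w hw]]; first by exists 0%N.
  by exists (4 * w + 1)%N; rewrite expnS; lia.
exists v%:Z, a, b, c, d, (2 ^ k)%N%:Z, (m./2)%:Z, w%:Z; split;
  first by rewrite -expr2 e; ring.
rewrite -[1]/(1%N%:Z) -!PoszD -!PoszM; congr Posz.
have hm : m = (m./2 + m./2 + 1)%N by rewrite addnn -{1}[m]odd_double_half om addnC.
by rewrite em -hw [in LHS]hm -mulnA.
Qed.

End FourSquares.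

Lemma definable_nonneg (f : (nat -> int) -> int) :
  dfun f -> definable (ring_language int) (fun v => (0 <= f v)%R).
Proof.
apply: (@definable_rel1 int (fun z => (0 <= z)%R : Prop)).
apply: definable_iff; first by move=> v; exact: nonneg_systemP.
rewrite /nonneg_system.
repeat (cbv beta; first [exact: dfun_var | exact: dfun_one | apply: dfunD | apply: dfunM
  | apply: definable_and | apply: definable_ex | apply: definable_eq]).
Qed.

(** Decoding is by absolute value, which is additive on nonnegative integers; the translated atoms
    therefore impose signs. *)
Lemma dioph_int P : dioph P ->
  exists2 P', definable (ring_language int) P' &
    forall v : nat -> nat, P' (Posz \o v) <-> P v.
Proof.
apply: (@definable_transfer (ring_language nat) (ring_language int) Posz absz) => // c.
have at_ c' := @definable_atom (ring_language int) c'.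
have nn i : definable (ring_language int) (fun v => (0 <= v i)%R).
  by apply: definable_nonneg; exact: dfun_var.
case: c => [i|i j k|i j k].
- exists (fun X => X i = 1%R); split;
  [exact: (at_ (IsOne i))|by move=> X /= ->|by move=> v /= ->].
- exists (fun X => (0 <= X i)%R /\ (0 <= X j)%R /\ (X i + X j = X k)%R); split.
  + by do 2!apply: definable_and => //; exact: (at_ (IsSum i j k)).
  + by move=> X [hi [hj e]] /=; rewrite -e /GRing.add /=; lia.
  + by move=> v /= <-.
- exists (fun X => (0 <= X i)%R /\ (0 <= X j)%R /\ (X i * X j = X k)%R); split.
  + by do 2!apply: definable_and => //; exact: (at_ (IsProd i j k)).
  + by move=> X [hi [hj e]] /=; rewrite -e abszM.
  + by move=> v /= <-.
Qed.

(** * Systems of group equations *)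

Section GroupLanguage.
Variables (G : groupType) (k : nat) (gens : k.-tuple G).
Local Open Scope group_scope.

Definition ren_letter (f : nat -> nat) (l : (nat + 'I_k) * bool) :=
  (match l.1 with inl i => inl (f i) | inr j => inr j end, l.2).

Definition ren_equation f (e : equation k) : equation k :=
  (map (ren_letter f) e.1, map (ren_letter f) e.2).

Lemma gval_ren f X w : Defs.gval (valuation gens X) (map (ren_letter f) w) =
  Defs.gval (valuation gens (X \o f)) w.
Proof. by rewrite /Defs.gval big_map; apply: eq_bigr => -[[i|j] b]. Qed.

Fact solves_ren f X e : solves gens X (ren_equation f e) <-> solves gens (X \o f) e.
Proof. by rewrite /solves /= !gval_ren. Qed.

Definition group_language := Language solves_ren.

Definition word_fun (t : (nat -> G) -> G) :=
  exists w, forall X, Defs.gval (valuation gens X) w = t X.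

Lemma word_var i : word_fun (fun X => X i).
Proof. by exists [:: (inl i, false)] => X; rewrite /Defs.gval big_seq1. Qed.

Lemma word_mul t1 t2 : word_fun t1 -> word_fun t2 -> word_fun (fun X => t1 X * t2 X).
Proof.
move=> [w1 h1] [w2 h2]; exists (w1 ++ w2) => X.
by rewrite -h1 -h2 /Defs.gval big_cat.
Qed.

Lemma word_const : generating gens -> forall g, word_fun (fun=> g).
Proof.
move=> gen g; have [w <-] := gen g.
exists [seq (inr l.1, l.2) | l <- w] => X; rewrite /Defs.gval big_map.
by apply: eq_bigr => -[j b].
Qed.

Lemma definable_word_eq t1 t2 : word_fun t1 -> word_fun t2 ->
  definable group_language (fun X => t1 X = t2 X).
Proof.
move=> [w1 h1] [w2 h2].
apply: definable_iff (@definable_atom group_language (w1, w2)) => X /=.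
by rewrite /solves /= h1 h2.
Qed.

End GroupLanguage.

(** * The integers in groups of matrices *)

Section Matrix3.
Local Open Scope ring_scope.

Definition i0 : 'I_3 := @Ordinal 3 0 isT.
Definition i1 : 'I_3 := @Ordinal 3 1 isT.
Definition i2 : 'I_3 := @Ordinal 3 2 isT.

Lemma ord3_ind (P : 'I_3 -> Prop) : P i0 -> P i1 -> P i2 -> forall i, P i.
Proof.
move=> P0 P1 P2 [[|[|[|//]]] lt3].
- by congr (P _): P0; exact: val_inj.
- by congr (P _): P1; exact: val_inj.
- by congr (P _): P2; exact: val_inj.
Qed.

Lemma mulmx3 (A B : 'M[int]_3) i j :
  (A *m B) i j = A i i0 * B i0 j + A i i1 * B i1 j + A i i2 * B i2 j.
Proof.
rewrite mxE !big_ord_recl big_ord0 addr0 addrA.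
by congr (A i _ * B _ j + A i _ * B _ j + A i _ * B _ j); exact: val_inj.
Qed.

(* The matrix [[e, a, b], [0, e, c], [0, 0, e]]. *)
Definition tri (e a b c : int) : 'M[int]_3 := \matrix_(i, j)
  match val i, val j with
  | 0%N, 1%N => a | 0%N, 2%N => b | 1%N, 2%N => c
  | x, y => if x == y then e else 0
  end.

Lemma tri_eq (A : 'M[int]_3) e a b c :
  A i0 i0 = e -> A i0 i1 = a -> A i0 i2 = b ->
  A i1 i0 = 0 -> A i1 i1 = e -> A i1 i2 = c ->
  A i2 i0 = 0 -> A i2 i1 = 0 -> A i2 i2 = e -> A = tri e a b c.
Proof. by move=> *; apply/matrixP; do 2!elim/ord3_ind; rewrite mxE /=. Qed.

Lemma tri_mul e a b c e' a' b' c' : tri e a b c *m tri e' a' b' c' =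
  tri (e * e') (e * a' + a * e') (e * b' + a * c' + b * e') (e * c' + c * e').
Proof. by apply: tri_eq; rewrite mulmx3 !mxE /=; ring. Qed.

Lemma tri1 : tri 1 0 0 0 = 1%:M.
Proof. by symmetry; apply: tri_eq; rewrite mxE. Qed.

Ltac entries h :=
  have := congr1 (fun A : 'M[int]_3 => A i0 i0) h;
  have := congr1 (fun A : 'M[int]_3 => A i0 i1) h;
  have := congr1 (fun A : 'M[int]_3 => A i0 i2) h;
  have := congr1 (fun A : 'M[int]_3 => A i1 i0) h;
  have := congr1 (fun A : 'M[int]_3 => A i1 i1) h;
  have := congr1 (fun A : 'M[int]_3 => A i1 i2) h;
  have := congr1 (fun A : 'M[int]_3 => A i2 i0) h;
  have := congr1 (fun A : 'M[int]_3 => A i2 i1) h;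
  have := congr1 (fun A : 'M[int]_3 => A i2 i2) h;
  rewrite !mulmx3 ![tri _ _ _ _ _ _]mxE /=.

Lemma centraliser12 (A : 'M[int]_3) :
  A *m tri 1 1 0 0 = tri 1 1 0 0 *m A -> A *m tri 1 0 1 0 = tri 1 0 1 0 *m A ->
  exists e a b, A = tri e a b 0.
Proof.
move=> h h'; exists (A i0 i0), (A i0 i1), (A i0 i2).
by apply: tri_eq => //; entries h; entries h'; lia.
Qed.

Lemma centraliser23 (A : 'M[int]_3) :
  A *m tri 1 0 0 1 = tri 1 0 0 1 *m A -> A *m tri 1 0 1 0 = tri 1 0 1 0 *m A ->
  exists e b c, A = tri e 0 b c.
Proof.
move=> h h'; exists (A i0 i0), (A i0 i2), (A i1 i2).
by apply: tri_eq => //; entries h; entries h'; lia.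
Qed.

Lemma tri_unit e a b c (B : 'M[int]_3) : B *m tri e a b c = 1%:M -> e != 0.
Proof.
move=> h; have := congr1 (fun A : 'M[int]_3 => A i0 i0) h.
rewrite mulmx3 !mxE /=; apply: contra_eq_neq => ->; rewrite !mulr0; lia.
Qed.

(** As e is nonzero the triangular factor can be cancelled over the rationals, so Z is 1 + (g/e)
    E13; the entries are determined column by column. *)
Lemma tri_solve (Z : 'M[int]_3) e a b c g : e != 0 ->
  Z *m tri e a b c = tri e a (b + g) c ->
  exists2 z, Z = tri 1 0 z 0 & z * e = g.
Proof.
move=> e0 h; entries h => h22 h21 h20 h12 h11 h10 h02 h01 h00.
have cancel x y : x * e = y * e -> x = y by apply: mulIf.
have e00 : Z i0 i0 = 1 by apply: cancel; lia.
have e10 : Z i1 i0 = 0 by apply: cancel; lia.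
have e20 : Z i2 i0 = 0 by apply: cancel; lia.
have e01 : Z i0 i1 = 0 by apply: cancel; move: h01; rewrite e00; lia.
have e11 : Z i1 i1 = 1 by apply: cancel; move: h11; rewrite e10; lia.
have e21 : Z i2 i1 = 0 by apply: cancel; move: h21; rewrite e20; lia.
have e12 : Z i1 i2 = 0 by apply: cancel; move: h12; rewrite e10 e11; lia.
have e22 : Z i2 i2 = 1 by apply: cancel; move: h22; rewrite e20 e21; lia.
exists (Z i0 i2); first exact: tri_eq.
by move: h02; rewrite e00 e01; lia.
Qed.

End Matrix3.

Section IntegersInGroup.
Variables (G : groupType) (k : nat) (gens : k.-tuple G).
(** A faithful representation [f] whose image contains all unitriangular matrices, lifted by [u], is
    what the three groups have in common. *)
Variables (f : G -> 'M[int]_3) (u : int -> int -> int -> G).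
Hypotheses (gen : generating gens) (f_inj : injective f) (f1 : f 1%g = 1%:M%R).
Hypothesis fM : forall x y, f (x * y)%g = (f x *m f y)%R.
Hypothesis fu : forall a b c, f (u a b c) = tri 1 a b c.
Local Notation t12 := (u 1 0 0).
Local Notation t13 := (u 0 1 0).
Local Notation t23 := (u 0 0 1).
Local Open Scope group_scope.

Definition group_int (a : int) : G := u 0 a 0.
Definition int_group (g : G) : int := f g i0 i2.

Lemma group_intK : cancel group_int int_group.
Proof. by move=> a; rewrite /int_group /group_int fu mxE. Qed.

(** The last equation says that z is the commutator [x, t23]. If x has diagonal entry e and entry a
    above it, this is t13(a/e), so the possible z are exactly the t13(n). *)
Definition int_sys (x z : G) : Prop :=
  x * t12 = t12 * x /\ x * t13 = t13 * x /\ z * (t23 * x) = x * t23.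

(** z1 = [x, t23], z2 = [t12, y] and z3 = [x, y]. With diagonal entries e and e' they are t13 of
    a/e, d/e' and ad/(ee'), so the product relation is insensitive to the signs. *)
Definition prod_sys (x y z1 z2 z3 : G) : Prop :=
  int_sys x z1 /\ y * t23 = t23 * y /\ y * t13 = t13 * y /\
  z2 * (y * t12) = t12 * y /\ z3 * (y * x) = x * y.

Lemma f_unit x : exists B, (B *m f x)%R = 1%:M%R.
Proof. by exists (f x^-1); rewrite -fM mulVg f1. Qed.

Lemma int_sys_sound x z : int_sys x z ->
  exists e a b, [/\ e != 0%R, f x = tri e a b 0, f z = tri 1 0 (int_group z) 0 &
    (int_group z * e)%R = a].
Proof.
move=> [/(congr1 f) + [/(congr1 f) + /(congr1 f)]]; rewrite !fM !fu.
move=> h h' hz; have [e [a [b ex]]] := centraliser12 h h'.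
have [B hB] := f_unit x; rewrite ex in hB hz.
have e0 := tri_unit hB; exists e, a, b.
have [c ec hc] : exists2 c, f z = tri 1 0 c 0 & (c * e)%R = a.
  move: hz; rewrite !tri_mul => hz.
  apply: (@tri_solve _ e a b e) => //.
  by congr ((_ *m _)%R = _): hz; congr tri; ring.
have <- : c = int_group z by rewrite /int_group ec mxE.
by [].
Qed.

Lemma prod_sys_sound x y z1 z2 z3 : prod_sys x y z1 z2 z3 ->
  (int_group z1 * int_group z2)%R = int_group z3.
Proof.
move=> [/int_sys_sound[e [a [b [e0 ex _ ea]]]]].
move=> [/(congr1 f) + [/(congr1 f) + [/(congr1 f) + /(congr1 f)]]]; rewrite !fM !fu.
move=> h h' hz2 hz3; have [e' [b' [d ey]]] := centraliser23 h h'.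
have [B hB] := f_unit y; rewrite ey in hB hz2 hz3; rewrite ex in hz3.
have e0' := tri_unit hB.
have [c ec hc] : exists2 c, f z2 = tri 1 0 c 0 & (c * e')%R = d.
  move: hz2; rewrite !tri_mul => hz.
  apply: (@tri_solve _ e' e' b' d) => //.
  by congr ((_ *m _)%R = _): hz; congr tri; ring.
have [g eg hg] : exists2 g, f z3 = tri 1 0 g 0 & (g * (e * e'))%R = (a * d)%R.
  move: hz3; rewrite !tri_mul => hz.
  apply: (@tri_solve _ (e * e') (a * e') (e' * b + e * b') (e * d))%R;
    first by rewrite mulf_neq0.
  by congr ((_ *m _)%R = _): hz; congr tri; ring.
have <- : c = int_group z2 by rewrite /int_group ec mxE.
have <- : g = int_group z3 by rewrite /int_group eg mxE.
apply: (@mulIf _ (e * e')%R); first by rewrite mulf_neq0.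
by rewrite hg -ea -hc; ring.
Qed.

Lemma u_mul a b c a' b' c' :
  (u a b c * u a' b' c')%g = u (a + a')%R (b + b' + a * c')%R (c + c')%R.
Proof. by apply: f_inj; rewrite fM !fu tri_mul; congr tri; ring. Qed.

Lemma int_sys_complete a : int_sys (u a 0 0) (group_int a).
Proof. by rewrite /int_sys /group_int !u_mul; split; [|split]; congr u; ring. Qed.

Lemma prod_sys_complete a b : prod_sys (u a 0 0) (u 0 0 b)
  (group_int a) (group_int b) (group_int (a * b)).
Proof.
split; first exact: int_sys_complete.
by rewrite /group_int !u_mul; do !split; congr u; ring.
Qed.

Local Notation defn := (definable (group_language gens)).

Ltac def_group := repeat (cbv beta; first
  [exact: word_var | exact: word_const | apply: word_mul
  | apply: definable_and | apply: definable_ex | apply: definable_word_eq]).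

(** Addition is multiplication in G. As [int_group] is additive on the elements t13(a), the sum atom
    also requires both summands to be of this form. *)
Lemma definable_int P : definable (ring_language int) P ->
  exists2 P', defn P' & forall v : nat -> int, P' (group_int \o v) <-> P v.
Proof.
apply: (@definable_transfer (ring_language int) (group_language gens)
  group_int int_group group_intK) => -[i|i j l|i j l].
- exists (fun X => X i = group_int 1); split; first by def_group.
    by move=> X /= ->; rewrite group_intK.
  by move=> v /= ->.
- exists (fun X => (exists x, int_sys x (X i)) /\ (exists x, int_sys x (X j)) /\
    (X i * X j)%g = X l); split; first by rewrite /int_sys; def_group.
    move=> X [[x /int_sys_sound[_ [_ [_ [_ _ hi _]]]]] [[y /int_sys_sound[_ [_ [_ [_
      _ hj _]]]]] e]] /=.
    by rewrite -e {3}/int_group fM hi hj tri_mul mxE /=; ring.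
  move=> v /= <-; split; first by exists (u (v i) 0 0)%R; exact: int_sys_complete.
  split; first by exists (u (v j) 0 0)%R; exact: int_sys_complete.
  by rewrite /group_int u_mul; congr u; ring.
- exists (fun X => exists x y, prod_sys x y (X i) (X j) (X l)); split.
  + by rewrite /prod_sys /int_sys; def_group.
  + by move=> X [x [y /prod_sys_sound]].
  + move=> v /= <-; exists (u (v i) 0 0)%R, (u 0 0 (v j))%R; exact: prod_sys_complete.
Qed.

End IntegersInGroup.

(** * The diagonal argument *)

Section Undecidability.
Variables (G : groupType) (f : G -> 'M[int]_3) (u : int -> int -> int -> G).
Hypotheses (f_inj : injective f) (f1 : f 1%g = 1%:M%R).
Hypothesis fM : forall x y, f (x * y)%g = (f x *m f y)%R.
Hypothesis fu : forall a b c, f (u a b c) = tri 1 a b c.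

Lemma group_int_expg n : (group_int u 1%Z ^+ n)%g = group_int u (Posz n).
Proof.
elim: n => [|n IH]; first by apply: f_inj; rewrite expg0 f1 fu tri1.
by rewrite expgS IH /group_int (u_mul f_inj fM fu); congr u; lia.
Qed.

(* [x_2 = x_0 ^+ n]; [definable] numbers the first two free variables 0 and 2. *)
Definition power_equation k n : equation k :=
  (nseq n (inl 0, false), [:: (inl 2, false)]).

Lemma solves_power_equation k (gens : k.-tuple G) x n :
  solves gens x (power_equation k n) <-> (x 0 ^+ n = x 2)%g.
Proof.
rewrite /solves /Defs.gval /= big_seq1 /=.
suff -> : (\prod_(l <- nseq n (@inl nat 'I_k 0%N, false))
    (if l.2 then (valuation gens x l.1)^-1 else valuation gens x l.1) = x 0%N ^+ n)%g
      by [].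
by elim: n => [|n IH]; rewrite ?big_nil // big_cons IH expgS.
Qed.

(** The number of the enlarged system when the original one has number n. Prepending m to a list of
    code c gives 2^m (2c + 1); the letter x_0 has number 0, so the word of n letters x_0 has number
    2^n - 1, and the word x_2 contributes a constant. *)
Definition diag_code k n : nat :=
  2 ^ (2 ^ (2 ^ n).-1 * (CodeSeq.code [:: @code_word k [:: (inl 2, false)]]).*2.+1) *
    n.*2.+1.

Lemma code_cons n s : CodeSeq.code (n :: s) = 2 ^ n * (CodeSeq.code s).*2.+1.
Proof. by []. Qed.

Lemma code_nseq n k : @code_word k (nseq n (inl 0, false)) = (2 ^ n).-1.
Proof.
rewrite /code_word map_nseq; elim: n => // n IH.
rewrite -[nseq n.+1 _]/(0 :: nseq n (@code_letter k (inl 0, false))) code_cons IH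
  expn0 mul1n expnS.
by have := expn_gt0 2 n; lia.
Qed.

Lemma code_power_cons k (S : system k) :
  code_system (power_equation k (code_system S) :: S) = diag_code k (code_system S).
Proof.
rewrite {1}/code_system map_cons code_cons -/(code_system S) /diag_code.
by rewrite /code_equation code_cons code_nseq.
Qed.

Lemma dioph_diag_code k f' : diophfun f' -> diophfun (fun v => diag_code k (f' v)).
Proof.
move=> df.
have dp g : diophfun g -> diophfun (fun v => (2 ^ g v).-1).
  apply: (@dfun_graph1 nat (fun n => (2 ^ n).-1)).
  have H : dioph (fun v => (v 0).+1 = 2 ^ v 1) by dio.
  apply: definable_iff H => v; have := expn_gt0 2 (v 1); split=> [<-//|->].
  by rewrite prednK.
rewrite /diag_code; move: (CodeSeq.code _) => c.
apply: dioph_mul; last first.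
  have -> : (fun v => (f' v).*2.+1) = (fun v => (f' v + f' v).+1).
    by apply: functional_extensionality => v; rewrite addnn.
  by dio.
apply: dioph_expn; first exact: dioph_const.
apply: dioph_mul; last exact: dioph_const.
by apply: dioph_expn; [exact: dioph_const|exact: dp].
Qed.

Lemma matrix_group_undecidable : diophantine_undecidable G.
Proof.
move=> k gens gen [M decM].
have dA : dioph (fun v => computes M (diag_code k (v 0)) 0).
  by apply/dioph_computes/dioph_diag_code; exact: dfun_var.
have [P1 dP1 hP1] := dioph_int dA.
have [P2 dP2 hP2] := definable_int gen f_inj f1 fM fu dP1.
(* The free variable 1, which is the parameter, sits at index 2 of [S], and t13(1) at index 0. *)
have [S hS] : definable (group_language gens)
    (fun X => X 0 = group_int u 1%Z /\ P2 (fun=> X 1)).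
  apply: definable_and; last exact: (definable_ren (fun=> 1) dP2).
  by apply: definable_word_eq; [exact: word_var|exact: word_const].
have satsP x T : sats (L := group_language gens) x T <->
    forall e : equation k, e \in T -> solves gens x e.
  elim: T => [|e T IH] //=; split=> [[h /IH hT] e'|h].
    by rewrite inE => /orP[/eqP->|/hT].
  split; first by apply: h; rewrite mem_head.
  by apply/IH => e' eT; apply: h; rewrite inE eT orbT.
pose n := code_system S.
(* The power equation with x_0 = t13(1) forces x_2 = t13(n), so the enlarged system asserts that [M]
   outputs 0 on its own number. *)
have solvableE : solvable_system gens (power_equation k n :: S) <->
    computes M (diag_code k n) 0.
  have hn : P2 (fun=> group_int u (Posz n)) <-> computes M (diag_code k n) 0.
    rewrite -(hP1 (fun=> n)); exact: (hP2 (fun=> Posz n)).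
  rewrite -hn; split=> [[x hx]|h].
    have hp : (x 0 ^+ n = x 2)%g.
      by apply/solves_power_equation/hx; rewrite mem_head.
    have [|x0] := (hS (fun i => x i.*2)).2.
      exists (fun i => x i.*2.+1); apply/satsP => e eS.
      have -> : mix (fun i => x i.*2) (fun i => x i.*2.+1) = x.
        apply: functional_extensionality => i; rewrite /mix -{4}[i]odd_double_half.
        by case: (odd i).
      by apply: hx; rewrite inE eS orbT.
    by rewrite /= in x0 *; rewrite -hp x0 group_int_expg.
  have [|w hw] := (hS (fun i => if i is 0 then group_int u 1%Z else group_int u (Posz
    n))).1.
    by [].
  exists (mix (fun i => if i is 0 then group_int u 1%Z else group_int u (Posz n)) w) => e.
  rewrite inE => /orP[/eqP->|eS]; last by have /satsP := hw; apply.
  by apply/solves_power_equation; rewrite /mix /= group_int_expg.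
have [b [cb hb]] := decM (power_equation k n :: S).
rewrite code_power_cons -/n in cb.
case: b cb hb => cb hb.
  by have /solvableE/(computes_inj cb) := hb.1 isT.
by have := hb.2 (solvableE.2 cb).
Qed.

End Undecidability.

(** * Unitriangular matrices in the three groups *)

Section Matrix3Groups.
Local Open Scope ring_scope.

Lemma tri_unitmx a b c : tri 1 a b c \in unitmx.
Proof.
have [] // := @mulmx1_unit _ _ (tri 1 a b c) (tri 1 (- a) (a * c - b) (- c)).
by rewrite tri_mul -tri1; congr tri; ring.
Qed.

Lemma tri_is_trig a b c : is_trig_mx (tri 1 a b c)^T.
Proof.
by apply/is_trig_mxP; do 2!elim/ord3_ind; rewrite !mxE.
Qed.

Lemma det_tri a b c : \det (tri 1 a b c) = 1.
Proof.
rewrite -det_tr det_trig ?tri_is_trig // big1 // => i _.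
by elim/ord3_ind: i; rewrite !mxE.
Qed.

Definition GLtri a b c : GL int 3 := MkGL (tri_unitmx a b c).

Lemma SLtri_subproof a b c : GLtri a b c \in SLpred (R := int) (n := 3).
Proof. by rewrite inE /= det_tri. Qed.

Definition SLtri a b c : SL int 3 := MkSL (SLtri_subproof a b c).

Lemma Ttri_subproof a b c : GLtri a b c \in Tpred (R := int) (n := 3).
Proof. by rewrite inE /= tri_is_trig. Qed.

Definition Ttri a b c : T int 3 := MkT (Ttri_subproof a b c).

End Matrix3Groups.

Theorem mainTheorem9 :
  [/\ diophantine_undecidable (GL int 3),
      diophantine_undecidable (SL int 3) &
      diophantine_undecidable (T int 3)].
Proof.
split.
- apply: (@matrix_group_undecidable _ (@GLmx int 3) GLtri) => //.
  exact: val_inj.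
- apply: (@matrix_group_undecidable _ (fun x : SL int 3 => GLmx x) SLtri) => //.
  by move=> x y e; do 2!apply: val_inj.
- apply: (@matrix_group_undecidable _ (fun x : T int 3 => GLmx x) Ttri) => //.
  by move=> x y e; do 2!apply: val_inj.
Qed.
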